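(* Let $k$ be an even integer and let $\varepsilon\in(0,1/6)$. Then for every positive integer $n$, every $n$-point metric with doubling dimension $d$ admits a $(1+\varepsilon)$-spanner with hop-diameter $k$ and arboricity $\varepsilon^{-O(d)}\alpha_{k/2+1}(n)$.
   Context: A $t$-spanner of a metric $(X,\delta)$ is a graph $H$ on $X$, each edge $(x,y)$ weighted by $\delta(x,y)$, such that $d_H(u,v)\le t\,\delta(u,v)$ for all $u,v\in X$; it has hop-diameter $k$ if for all $u,v$ such a path of length at most $t\,\delta(u,v)$ exists with at most $k$ edges. Arboricity of $H$: $\max_{H'\subseteq H,|V(H')|\ge2}\lceil |E(H')|/(|V(H')|-1)\rceil$. Ackermann functions: $A(0,n)=2n$; for $k\ge1$, $A(k,0)=1$, $A(k,n)=A(k-1,A(k,n-1))$; $B(0,n)=n^2$; for $k\ge1$, $B(k,0)=2$, $B(k,n)=B(k-1,B(k,n-1))$. Inverse Ackermann: $\alpha_{2k}(n)=\min\{s\ge0:A(k,s)\ge n\}$, $\alpha_{2k+1}(n)=\min\{s\ge0:B(k,s)\ge n\}$. Doubling dimension is the standard notion.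
   Formalization: The even integer k is taken positive (hop-diameter k ≤ 0 is impossible for n ≥ 2), and α_{k/2+1}(n) is replaced by max(1, α_{k/2+1}(n)), since for n = 2 and 4 | k it is 0 while two points need an edge (arboricity 1). *)

(* Defs.v *)
From HB Require Import structures.
From mathcomp Require Import all_boot all_order all_algebra.
From mathcomp Require Import all_classical all_reals all_analysis.
Set Implicit Arguments.
Unset Strict Implicit.
Unset Printing Implicit Defensive.
Import Order.TTheory GRing.Theory Num.Theory.
Local Open Scope ring_scope.

Definition is_metric (R : realType) (X : finType) (delta : X -> X -> R) : Prop :=
  [/\ forall x y, 0 <= delta x y,
      forall x y, delta x y = 0 <-> x = y,
      forall x y, delta x y = delta y x
    & forall x y z, delta x z <= delta x y + delta y z].

(* Every closed ball is covered by at most 2^d closed balls of half the radius,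
   centred at points of the space. *)
Definition is_doubling (R : realType) (X : finType) (delta : X -> X -> R)
    (d : R) : Prop :=
  forall (x : X) (r : R), 0 < r ->
    exists2 S : {set X}, (#|S|)%:R <= 2 `^ d &
      forall y, delta x y <= r -> exists2 c, c \in S & delta c y <= r / 2.

Definition doubling_dimension (R : realType) (X : finType)
    (delta : X -> X -> R) (d : R) : Prop :=
  is_doubling delta d /\ forall d', is_doubling delta d' -> d <= d'.

(* A graph on the vertex type X is given by its set E of edges, an edge being
   an unordered pair of distinct vertices. *)
Definition simple_graph (X : finType) (E : {set {set X}}) : Prop :=
  forall e, e \in E -> #|e| = 2%N.

Definition adj (X : finType) (E : {set {set X}}) : rel X :=
  fun x y => [set x; y]%SET \in E.

(* As in the library's [path], the walk x :: p starts at x, ends at last x p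
   and has size p edges. *)
Definition walk_length (R : realType) (X : finType) (delta : X -> X -> R)
    (x : X) (p : seq X) : R :=
  \sum_(w <- pairmap delta x p) w.

(* Equal to +oo when v is not reachable from u. *)
Definition graph_dist (R : realType) (X : finType) (delta : X -> X -> R)
    (E : {set {set X}}) (u v : X) : \bar R :=
  ereal_inf [set (walk_length delta u p)%:E |
             p in [set p | path (adj E) u p /\ last u p = v]]%classic.

Definition spanner (R : realType) (X : finType) (delta : X -> X -> R) (t : R)
    (E : {set {set X}}) : Prop :=
  simple_graph E /\
  forall u v, (graph_dist delta E u v <= (t * delta u v)%:E)%E.

Definition spanner_hop_diameter (R : realType) (X : finType)
    (delta : X -> X -> R) (t : R) (E : {set {set X}}) (k : nat) : Prop :=
  forall u v, exists p : seq X,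
    [/\ path (adj E) u p, last u p = v,
        walk_length delta u p <= t * delta u v & (size p <= k)%N].

(* G.1 is the vertex set and G.2 the edge set of the subgraph. *)
Definition subgraph (X : finType) (G : {set X} * {set {set X}})
    (E : {set {set X}}) : bool :=
  (G.2 \subset E) && [forall e in G.2, e \subset G.1].

Definition arboricity (X : finType) (E : {set {set X}}) : nat :=
  \max_(G : {set X} * {set {set X}} | subgraph G E && (2 <= #|G.1|)%N)
    `|Num.ceil ((#|G.2|)%:R / (#|G.1| - 1)%:R : rat)|%N.

Fixpoint ackA (k : nat) : nat -> nat :=
  match k with
  | 0%N => fun n => (2 * n)%N
  | k'.+1 => fun n => iter n (ackA k') 1%N
  end.

Fixpoint ackB (k : nat) : nat -> nat :=
  match k with
  | 0%N => fun n => (n ^ 2)%N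
  | k'.+1 => fun n => iter n (ackB k') 2%N
  end.

Lemma ackA_rec k :
  ackA k.+1 0 = 1%N /\ forall n, ackA k.+1 n.+1 = ackA k (ackA k.+1 n).
Proof. by []. Qed.

Lemma ackB_rec k :
  ackB k.+1 0 = 2%N /\ forall n, ackB k.+1 n.+1 = ackB k (ackB k.+1 n).
Proof. by []. Qed.

Lemma ackA_gt k n : (0 < n)%N -> (n < ackA k n)%N.
Proof.
elim: k n => [|k IHk] n n_gt0; first by rewrite /= mul2n -addnn -addn1 leq_add2l.
rewrite {n_gt0} /=; elim: n => [//|n IHn] /=.
by apply: (leq_ltn_trans IHn); apply: IHk; apply: leq_trans IHn.
Qed.

Lemma ackB_gt k n : (1 < n)%N -> (n < ackB k n)%N.
Proof.
elim: k n => [|k IHk] n n_gt1.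
  by rewrite /= -mulnn -[X in (X < _)%N]muln1 ltn_pmul2l // ltnW.
suff : (n.+1 < ackB k.+1 n)%N by apply: ltnW.
rewrite {n_gt1} /=; elim: n => [//|n IHn] /=.
by apply: (leq_ltn_trans IHn); apply: IHk; apply: leq_trans IHn.
Qed.

Lemma ackA_unbounded k n : exists s, (n <= ackA k s)%N.
Proof. by exists n.+1; apply: leq_trans (leqnSn _) (ltnW (ackA_gt k _)). Qed.

Lemma ackB_unbounded k n : exists s, (n <= ackB k s)%N.
Proof.
by exists n.+2; apply: leq_trans (ltnW (ackB_gt k _)) => //; rewrite -addn2 leq_addr.
Qed.

Definition inv_ackermann (i n : nat) : nat :=
  if odd i then ex_minn (ackB_unbounded i./2 n)
  else ex_minn (ackA_unbounded i./2 n).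

Lemma inv_ackermann_gt0 i n : (1 < i)%N -> (2 < n)%N -> (0 < inv_ackermann i n)%N.
Proof.
rewrite /inv_ackermann => i_gt1 n_gt2.
have: (0 < i./2)%N by case: i i_gt1 => [|[|i]].
by case: i./2 => // j _; case: ifP => _; case: ex_minnP => -[|s] //= hs _;
  move: (leq_trans n_gt2 hs).
Qed.

(* The positivity above fails at n = 2 for odd i: the single edge needed by a
   two-point space already has arboricity 1. *)
Lemma inv_ackermann_odd2 i : (1 < i)%N -> odd i -> inv_ackermann i 2 = 0%N.
Proof.
rewrite /inv_ackermann => i_gt1 ->.
have: (0 < i./2)%N by case: i i_gt1 => [|[|i]].
by case: i./2 => // j _; case: ex_minnP => s _ /(_ 0%N isT); case: s.
Qed.

(* Main.v *)
(** For each scale, a net can be coloured with eps^(-O(d)) colours so that nearby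
    points differ. Fixing one colour to direct the choice of parents and another
    to direct the choice of the leader of each cluster turns the nets into a
    rooted tree on the points themselves. As the two colours vary, every pair
    u, v has a tree in which both lie in the same cluster at the scale of their
    distance, while the tree path stays in the two small child clusters except
    for one edge; its length is then at most (1 + eps) delta u v.

    It remains to shortcut a rooted tree with k hops and out-degree
    O(alpha_{k/2+1}(n)). Cut vertices split the tree into pieces of size less than
    b; every vertex gets heavy edges to the at most two cut vertices bordering its
    piece, and one recurses in the pieces. The cut vertices are joined by the
    structure for k - 4 hops, in which each heavy edge is subdivided by a host; a
    path has at most two heavy edges, so this costs two hops, and the new heavy
    edges cost two more. Since each cut vertex comes with about b / 2 vertices of
    its own subtree, b need only be a multiple of the old degree, and the depth of
    the recursion is the iterated inverse of the old bound, one Ackermann level up.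
    A host may be any vertex of a subtree which the path enters or leaves, because
    the detour is at most the diameter of that cluster; hosts are therefore placed
    once and for all, by Hall's condition. *)

Require Import Defs.
From HB Require Import structures.
From mathcomp Require Import all_boot all_order all_algebra.
From mathcomp Require Import all_classical all_reals all_analysis.
From mathcomp Require Import zify ring lra.
From mathcomp Require Import fintype finset.
Set Implicit Arguments.
Unset Strict Implicit.
Unset Printing Implicit Defensive.

(** * Cut vertices of a rooted tree *)

(** [le x y] means that [y] is an ancestor of [x]: ancestors form a chain and any two vertices share
    one, so the root of the finite tree is the greatest element. *)
Definition tree_order (X : finType) (le : rel X) : Prop :=
  [/\ reflexive le, antisymmetric le, transitive le,
      forall x y z, le x y -> le x z -> le y z || le z y
    & forall x y, exists2 z, le x z & le y z].

Section TreeOrder.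
Variables (X : finType) (le : rel X).
Hypothesis le_tree : tree_order le.

Let lexx : reflexive le. Proof. by case: le_tree. Qed.
Let le_anti x y : le x y -> le y x -> x = y.
Proof. by case: le_tree => _ + _ _ _ xy yx => /(_ x y); rewrite xy yx; apply. Qed.
Let le_tr y x z : le x y -> le y z -> le x z.
Proof. by case: le_tree => _ _ + _ _; apply. Qed.
Let le_chain x y z : le x y -> le x z -> le y z \/ le z y.
Proof. by case: le_tree => _ _ _ h _ xy xz; apply/orP/(h x). Qed.

(** [z] lies on the tree path from [u] to [v], expressed without edges: no subtree separates [z]
    from both [u] and [v]. *)
Definition btw (u z v : X) : bool :=
  [forall r, (le u r && le v r ==> le z r) && (le z r ==> le u r || le v r)].

Lemma btwP u z v :
  reflect (forall r, (le u r -> le v r -> le z r) /\ (le z r -> le u r \/ le v r))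
          (btw u z v).
Proof.
apply: (iffP forallP) => h r; have := h r.
  case/andP => /implyP h1 /implyP h2; split=> [ur vr|zr].
    by apply: h1; rewrite ur.
  by apply/orP/h2.
case=> h1 h2; apply/andP; split; apply/implyP.
  by case/andP; apply: h1.
by move=> /h2 /orP.
Qed.

Lemma btwC u z v : btw u z v = btw v z u.
Proof. by apply/btwP/btwP => h r; have := h r; tauto. Qed.

Lemma btw_l u v : btw u u v.
Proof. by apply/btwP => r; tauto. Qed.

Lemma btw_r u v : btw u v v.
Proof. by apply/btwP => r; tauto. Qed.

Lemma btwuu u z : btw u z u -> z = u.
Proof.
move/btwP => h; apply: le_anti; first by case: (h u) => + _; apply.
by case: (h z) => _ /(_ (lexx z)) [].
Qed.

Lemma btw_tr u c r v : btw u c r -> btw u r v -> btw u c v.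
Proof. by move=> /btwP h1 /btwP h2; apply/btwP => s; have := h1 s; have := h2 s; tauto. Qed.

Lemma btw_trr u c r v : btw u c r -> btw u r v -> btw c r v.
Proof. by move=> /btwP h1 /btwP h2; apply/btwP => s; have := h1 s; have := h2 s; tauto. Qed.

(** The detour through [y] covers the path from [x] to [z]. The case to exclude has [c] above all
    three points. Then [x, y] and [y, z] have common ancestors that are not above [c]; both lie
    above [y], hence are comparable, and the higher one contradicts the hypothesis. *)
Lemma btw_split x c z y : btw x c z -> btw x c y \/ btw y c z.
Proof.
wlog xc : x z / le x c => [wl h|].
  have /btwP/(_ c) [_ /(_ (lexx c))] := h.
  case=> [xc|zc]; first exact: wl.
  rewrite btwC in h; have [h1|h1] := wl _ _ zc h.
    by right; rewrite btwC.
  by left; rewrite btwC.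
move=> /btwP h.
have [yc|yc] := boolP (le y c); last first.
  left; apply/btwP => r; split=> [xr yr|cr]; last by left; apply: le_tr cr.
  by have [//|rc] := le_chain xc xr; rewrite (le_tr yr rc) in yc.
have [zc|zc] := boolP (le z c); last first.
  right; apply/btwP => r; split=> [yr zr|cr]; last by left; apply: le_tr cr.
  by have [//|rc] := le_chain yc yr; rewrite (le_tr zr rc) in zc.
have [|n1] := boolP (btw x c y); first by left.
have [|n2] := boolP (btw y c z); first by right.
exfalso; have {n1}[r1 [x1 y1 c1]] : exists r, [/\ le x r, le y r & ~~ le c r].
  have [/existsP[r /and3P[]]|] := boolP [exists r, [&& le x r, le y r & ~~ le c r]].
    by exists r.
  move=> /existsPn n; case/negP: n1; apply/btwP => r; split=> [xr yr|cr].
    by have := n r; rewrite xr yr /= negbK.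
  by left; apply: le_tr cr.
have {n2}[r2 [y2 z2 c2]] : exists r, [/\ le y r, le z r & ~~ le c r].
  have [/existsP[r /and3P[]]|] := boolP [exists r, [&& le y r, le z r & ~~ le c r]].
    by exists r.
  move=> /existsPn n; case/negP: n2; apply/btwP => r; split=> [yr zr|cr].
    by have := n r; rewrite yr zr /= negbK.
  by left; apply: le_tr cr.
have [r12|r21] := le_chain y1 y2.
  by case/negP: c2; case: (h r2) => + _; apply=> //; apply: le_tr r12.
by case/negP: c1; case: (h r1) => + _; apply=> //; apply: le_tr r21.
Qed.

Definition is_lca (z u v : X) : Prop :=
  [/\ le u z, le v z & forall r, le u r -> le v r -> le z r].

Lemma is_lcaC z u v : is_lca z u v -> is_lca z v u.
Proof. by case=> h1 h2 h3; split=> // r r1 r2; apply: h3. Qed.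

Lemma lca_btw z u v : is_lca z u v -> btw u z v.
Proof.
case=> uz vz h; apply/btwP => r; split; first exact: h.
by move=> zr; left; apply: le_tr zr.
Qed.

Lemma le_btw u z w : le u z -> le z w -> btw u z w.
Proof.
by move=> uz zw; apply/btwP => r; split=> [_ /(le_tr zw)//|/(le_tr uz)]; left.
Qed.

Definition below (Y : {set X}) (r : X) : {set X} := [set x in Y | le x r].

Lemma lca_exists u v : exists z, is_lca z u v.
Proof.
have [z0 uz0 vz0] : exists2 z, le u z & le v z by case: le_tree.
pose P z := le u z && le v z.
have Pz0 : P z0 by rewrite /P uz0 vz0.
case: (arg_minnP (fun z => #|below setT z|) Pz0) => z /andP[uz vz] zmin.
exists z; split=> // r ur vr.
have [//|rz] := le_chain uz ur.
have := zmin r; rewrite /P ur vr => /(_ isT) le_card.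
have sub : below setT r \subset below setT z.
  by apply/subsetP => x; rewrite !inE => /le_tr; apply.
have /eqP e : below setT r == below setT z by rewrite eqEcard sub le_card.
have : z \in below setT z by rewrite !inE lexx.
by rewrite -e !inE.
Qed.

(** The invariant of the recursion, inherited by the cut vertices and by the pieces between them; it
    puts the top of each piece inside the piece. *)
Definition lca_closed (Y : {set X}) : Prop :=
  forall u v, u \in Y -> v \in Y -> exists2 z, z \in Y & is_lca z u v.

Lemma lca_closedT : lca_closed setT.
Proof. by move=> u v _ _; have [z hz] := lca_exists u v; exists z. Qed.

Lemma lca_closed_max (Y : {set X}) (r : X) : lca_closed Y -> below Y r != set0 ->
  exists2 m, m \in below Y r & forall x, x \in below Y r -> le x m.
Proof.
move=> cY /set0Pn[x0 x0r].
case: (@arg_maxnP _ x0 (mem (below Y r)) (fun z => #|below Y z|) x0r) => m /= mr mmax.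
exists m => // x xr.
have [mY mler] : m \in Y /\ le m r by move: mr; rewrite inE => /andP.
have [xY xler] : x \in Y /\ le x r by move: xr; rewrite inE => /andP.
have [z zY zl] := cY _ _ mY xY; case: (zl) => mz xz zmin.
have : z \in below Y r by rewrite inE zY zmin.
move=> /mmax le_card.
have sub : below Y m \subset below Y z.
  by apply/subsetP => y; rewrite !inE => /andP[-> /le_tr]; apply.
have /eqP e : below Y m == below Y z by rewrite eqEcard sub.
have : x \in below Y z by rewrite inE xY.
by rewrite -e inE => /andP[].
Qed.

(** * Choice and number of the cut vertices *)

Definition phi (Y : {set X}) (b : nat) (r : X) : nat := #|below Y r| %/ b.

(** The lowest vertices at which [phi], the number of full blocks of [b] vertices in a subtree,
    takes a positive value; incomparable vertices may share a value. *)
Definition cuts (Y : {set X}) (b : nat) : {set X} :=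
  [set r in Y | (0 < phi Y b r) &&
     [forall y in Y, le y r && (y != r) ==> (phi Y b y < phi Y b r)]].

Lemma cutsP (Y : {set X}) b r :
  reflect [/\ r \in Y, 0 < phi Y b r &
            forall y, y \in Y -> le y r -> y != r -> phi Y b y < phi Y b r]
          (r \in cuts Y b).
Proof.
rewrite inE; apply: (iffP and3P) => -[rY r0 h]; split=> //.
  move=> y yY yr ynr; by have /implyP := forall_inP h y yY; rewrite yr ynr; apply.
by apply/forall_inP => y yY; apply/implyP => /andP[]; apply: h.
Qed.

Lemma cuts_sub Y b : cuts Y b \subset Y.
Proof. by apply/subsetP => r /cutsP[]. Qed.

Lemma below_mono (Y : {set X}) x y : le x y -> below Y x \subset below Y y.
Proof. by move=> xy; apply/subsetP => z; rewrite !inE => /andP[-> zx]; apply: le_tr xy. Qed.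

Lemma phi_mono Y b x y : le x y -> phi Y b x <= phi Y b y.
Proof. by move=> xy; rewrite leq_div2r // subset_leq_card // below_mono. Qed.

(** Among the descendants of [z] with the same value of [phi], one with the smallest subtree is a
    cut vertex. *)
Lemma cut_below (Y : {set X}) b z : z \in Y -> 0 < phi Y b z ->
  exists c, [/\ c \in cuts Y b, le c z & phi Y b c = phi Y b z].
Proof.
move=> zY z0; pose P y := [&& y \in Y, le y z & phi Y b y == phi Y b z].
have Pz : P z by rewrite /P zY lexx eqxx.
case: (arg_minnP (fun y => #|below Y y|) Pz) => c /and3P[cY cz /eqP ec] cmin.
exists c; split=> //; apply/cutsP; split=> //; first by rewrite ec.
move=> y yY yc ync; rewrite ltn_neqAle phi_mono // andbT.
apply/negP => /eqP ey; have : P y by rewrite /P yY (le_tr yc cz) ey ec eqxx.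
move/cmin; apply/negP; rewrite -ltnNge; apply: proper_card.
apply/properP; split; first exact: below_mono.
exists c; rewrite !inE cY ?lexx //=; apply/negP => cy.
by rewrite (le_anti yc cy) eqxx in ync.
Qed.

Lemma below_disjoint (Y : {set X}) x y : ~~ le x y -> ~~ le y x -> [disjoint below Y x & below Y y].
Proof.
move=> xy yx; rewrite -setI_eq0; apply/eqP/setP => z; rewrite !inE.
apply/negP => /andP[/andP[_ zx] /andP[_ zy]].
by have [h|h] := le_chain zx zy; [rewrite h in xy|rewrite h in yx].
Qed.

Lemma card_below_disjoint Y x y z : ~~ le x y -> ~~ le y x -> le x z -> le y z ->
  #|below Y x| + #|below Y y| <= #|below Y z|.
Proof.
move=> xy yx xz yz; have := below_disjoint Y xy yx; rewrite -setI_eq0 => /eqP h0.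
rewrite -cardsUI h0 cards0 addn0 subset_leq_card // subUset.
by rewrite !below_mono.
Qed.

(** For incomparable cut vertices [u] and [v] with lowest common ancestor [z], a proper descendant
    [y] of [z] misses one of them, say [u]. If [y] is not below [u], the subtree of [u] adds at
    least [b] vertices to that of [y]; if it is, the subtree of [v] adds them to that of [u]. Either
    way [phi] is larger at [z]. *)
Lemma cuts_lca_closed Y b : 0 < b -> lca_closed Y -> lca_closed (cuts Y b).
Proof.
move=> b0 cY u v uC vC.
have [uv|uv] := boolP (le u v); first by exists v => //; split.
have [vu|vu] := boolP (le v u); first by exists u => //; split.
have /cutsP[uY u0 _] := uC; have /cutsP[vY v0 _] := vC.
have [z zY zl] := cY _ _ uY vY; exists z => //; case: (zl) => uz vz zmin.
have phi_b x : 0 < phi Y b x -> b <= #|below Y x| by rewrite divn_gt0.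
apply/cutsP; split=> //; first exact: leq_trans u0 (phi_mono _ _ uz).
move=> y yY yz ynz.
wlog uy : u v uC vC uv vu uY vY u0 v0 zl uz vz zmin / ~~ le u y => [wl|].
  have [uy|uy] := boolP (le u y); last exact: (wl u v).
  apply: (wl v u) => //; first exact: is_lcaC.
    by move=> r vr ur; apply: zmin.
  by apply/negP => vy; rewrite (le_anti yz (zmin _ uy vy)) eqxx in ynz.
have key x : ~~ le u x -> ~~ le x u -> le x z -> phi Y b x < phi Y b z.
  move=> ux xu xz; have := card_below_disjoint Y ux xu uz xz; rewrite addnC.
  move=> /(leq_trans (leq_add (leqnn _) (phi_b _ u0))) h.
  have := leq_div2r b h.
  by rewrite divnDr ?dvdnn // divnn b0 addn1.
have [yu|yu] := boolP (le y u); last exact: key.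
apply: leq_ltn_trans (phi_mono _ _ yu) _.
have := card_below_disjoint Y uv vu uz vz.
move=> /(leq_trans (leq_add (leqnn _) (phi_b _ v0))) h.
have := leq_div2r b h.
by rewrite divnDr ?dvdnn // divnn b0 addn1.
Qed.

Lemma leq_card_bigcup (I T : finType) (P : pred I) (F : I -> {set T}) :
  #|\bigcup_(i | P i) F i| <= \sum_(i | P i) #|F i|.
Proof.
elim/big_ind2: _ => [|A m B n hA hB|//]; first by rewrite cards0.
by rewrite cardsU; apply: leq_trans (leq_subr _ _) (leq_add hA hB).
Qed.

Lemma card_bigcup_disjoint (I T : finType) (P : pred I) (F : I -> {set T}) :
  (forall i j, P i -> P j -> i != j -> [disjoint F i & F j]) ->
  #|\bigcup_(i | P i) F i| = \sum_(i | P i) #|F i|.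
Proof.
move=> dF; rewrite -(eq_card (in_set _)) -sum1_card.
transitivity (\sum_(i | P i) \sum_(x in F i) 1); last first.
  by apply: eq_bigr => i _; rewrite sum1_card.
rewrite (exchange_big_dep (mem (\bigcup_(i | P i) F i))) /=; last first.
  by move=> i x Pi xi; apply/bigcupP; exists i.
rewrite (eq_bigl (mem (\bigcup_(i | P i) F i))) => [|x]; last by rewrite !inE.
apply: eq_bigr => x /bigcupP[i Pi xi].
rewrite (big_pred1 i) // => j; apply/andP/eqP => [[Pj xj]|->//].
apply/eqP/negPn/negP => ji; have := dF _ _ Pj Pi ji.
by rewrite disjoint_subset => /subsetP/(_ x xj); rewrite !inE xi.
Qed.

Lemma maximal_above (S : {set X}) x : x \in S ->
  exists m, [/\ m \in S, le x m & forall y, y \in S -> le m y -> y = m].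
Proof.
move=> xS; pose P z := (z \in S) && le x z; have Px : P x by rewrite /P xS lexx.
case: (arg_maxnP (fun z => #|below S z|) Px) => m /andP[mS xm] mmax.
exists m; split=> // y yS my; apply: le_anti => //.
have := mmax y; rewrite /P yS (le_tr xm my) => /(_ isT) le_card.
have /eqP e : below S m == below S y by rewrite eqEcard below_mono.
have : y \in below S y by rewrite inE yS lexx.
by rewrite -e inE => /andP[].
Qed.

(** Induction on the number of cut vertices: under the top one [c], the maximal remaining ones have
    disjoint subtrees, so their values of [phi] sum to at most [phi Y b c]. *)
Lemma card_cuts (Y : {set X}) b r : 0 < b -> lca_closed Y -> below (cuts Y b) r != set0 ->
  #|below (cuts Y b) r| < 2 * phi Y b r.
Proof.
move=> b0 cY; set C := cuts Y b; have cC : lca_closed C by apply: cuts_lca_closed.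
have [n] := ubnP #|below C r|; elim: n => // n IHn in r * => hn rC.
have [c cr cmax] := lca_closed_max cC rC.
move: (cr); rewrite inE => /andP[cC' cler].
apply: leq_trans (leq_mul (leqnn 2) (phi_mono Y b cler)).
have e : below C r = below C c.
  apply/eqP; rewrite eqEsubset (below_mono C cler) andbT; apply/subsetP => x xr.
  by rewrite inE cmax // andbT; move: xr; rewrite inE => /andP[].
rewrite {cmax rC cr cler r}e in hn *.
pose S := below C c :\ c.
pose M := [set m in S | [forall x in S, le m x ==> (x == m)]].
have MP m x : m \in M -> x \in S -> le m x -> x = m.
  rewrite inE => /andP[_ /forall_inP h] xS mx.
  by have /implyP/(_ mx)/eqP := h _ xS.
have MS m : m \in M -> [/\ m \in C, le m c & m != c].
  by rewrite !inE => /andP[/and3P[? ? ?] _].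
have sub : below C c \subset c |: \bigcup_(m in M) below C m.
  apply/subsetP => x xc; rewrite in_setU1; have [//|xnc] := eqVneq x c.
  have xS : x \in S by rewrite inE in_set1 xnc.
  have [m [mS xm mmax]] := maximal_above xS.
  apply/bigcupP; exists m.
    rewrite inE mS; apply/forall_inP => y yS; apply/implyP => my.
    by rewrite (mmax y).
  by move: xc; rewrite !inE xm => /andP[->].
have card_le : #|below C c| <= 1 + \sum_(m in M) #|below C m|.
  apply: leq_trans (subset_leq_card sub) _.
  rewrite cardsU1; apply: leq_add; first by case: (_ \notin _).
  exact: leq_card_bigcup.
have IH m : m \in M -> #|below C m| < 2 * phi Y b m.
  move=> /MS[mC mc mnc]; apply: IHn; last first.
    by apply/set0Pn; exists m; rewrite inE mC lexx.
  rewrite ltnS in hn; apply: leq_trans hn; apply: proper_card; apply/properP.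
  split; first exact: below_mono.
  exists c; first by rewrite inE cC' lexx.
  by rewrite inE cC' /=; apply/negP => cm; rewrite (le_anti mc cm) eqxx in mnc.
have sum_phi : \sum_(m in M) phi Y b m <= phi Y b c.
  rewrite /phi leq_divRL // big_distrl /=.
  apply: (@leq_trans (\sum_(m in M) #|below Y m|)).
    by apply: leq_sum => m _; apply: leq_divM.
  rewrite -card_bigcup_disjoint; last first.
    move=> i j iM jM ij; apply: below_disjoint; apply/negP => h.
      have jS : j \in S by move: jM; rewrite inE => /andP[].
      by rewrite (MP _ _ iM jS h) eqxx in ij.
    have iS : i \in S by move: iM; rewrite inE => /andP[].
    by rewrite (MP _ _ jM iS h) eqxx in ij.
  apply: subset_leq_card; apply/bigcupsP => m /MS[_ mc _]; exact: below_mono.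
have sumI : \sum_(m in M) #|below C m| + #|M| <= 2 * \sum_(m in M) phi Y b m.
  by rewrite -sum1_card -big_split /= big_distrr leq_sum // => m /IH; rewrite addn1.
have /cutsP[_ c0 ck] := cC'.
(* The bounds for the members of [M] save [#|M|] in total, which pays for [c] when [#|M|] is at
   least 2. A single member uses the strict growth of [phi] at the cut vertex [c], and an empty [M]
   uses its positivity. *)
case E : #|M| => [|[|k]].
- have M0 : M = set0 by apply/eqP; rewrite -cards_eq0 E.
  rewrite M0 big_set0 addn0 in card_le; lia.
- have /cards1P[m Mm] : #|M| == 1 by rewrite E.
  have mM : m \in M by rewrite Mm set11.
  have [mC mc mnc] := MS _ mM.
  have := ck _ (subsetP (cuts_sub _ _) _ mC) mc mnc.
  by have := IH _ mM; rewrite Mm big_set1 in card_le; lia.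
- lia.
Qed.

Lemma card_cuts_below (Y : {set X}) b r : 0 < b -> lca_closed Y ->
  b * #|below (cuts Y b) r| <= 2 * #|below Y r|.
Proof.
move=> b0 cY; have [->|h] := eqVneq (below (cuts Y b) r) set0.
  by rewrite cards0 muln0.
have := card_cuts b0 cY h; have : phi Y b r * b <= #|below Y r| by apply: leq_divM.
by nia.
Qed.

(** * Pieces between the cut vertices and their borders *)

Definition component (Y C : {set X}) (x : X) : {set X} :=
  [set y in Y :\: C | [forall c in C, ~~ btw x c y]].

Lemma componentP (Y C : {set X}) x y :
  reflect [/\ y \in Y, y \notin C & forall c, c \in C -> ~~ btw x c y] (y \in component Y C x).
Proof.
rewrite !inE; apply: (iffP andP) => [[/andP[h1 h2] /forall_inP h3]|[h1 h2 h3]].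
  by split.
by rewrite h1 h2; split=> //; apply/forall_inP.
Qed.

Lemma component_refl (Y C : {set X}) x : x \in Y -> x \notin C -> x \in component Y C x.
Proof.
move=> xY xC; apply/componentP; split=> // c cC; apply/negP => /btwuu e.
by rewrite -e cC in xC.
Qed.

Lemma component_eq (Y C : {set X}) x y : y \in component Y C x -> component Y C y = component Y C x.
Proof.
move=> /componentP[yY yC xy]; apply/setP => z; apply/componentP/componentP;
  move=> -[zY zC h]; split=> // c cC.
  apply/negP => /(btw_split y)[|] b; last by have := h _ cC; rewrite b.
  by have := xy _ cC; rewrite b.
apply/negP => /(btw_split x)[|] b; last by have := h _ cC; rewrite b.
by rewrite btwC in b; have := xy _ cC; rewrite b.
Qed.

Lemma component_lca_closed (Y C : {set X}) x : lca_closed Y -> lca_closed (component Y C x).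
Proof.
move=> cY u v uK vK; have /componentP[uY uC xu] := uK; have /componentP[vY vC xv] := vK.
have [z zY zl] := cY _ _ uY vY; exists z => //.
have uvC c : c \in C -> ~~ btw u c v.
  move=> cC; rewrite -(component_eq uK) in vK.
  by case/componentP: vK => _ _; apply.
rewrite -(component_eq uK); apply/componentP; split=> //.
  by apply/negP => /uvC; rewrite lca_btw.
by move=> c cC; apply/negP => /btw_tr/(_ (lca_btw zl)); apply/negP/uvC.
Qed.

(** The piece has a top [t]. Either the subtree of [t] has fewer than [b] vertices, or some cut
    vertex [c] below [t] has the same quotient by [b]; the piece avoids the subtree of [c], and two
    numbers with equal quotients differ by less than [b]. *)
Lemma card_component (Y : {set X}) b x : 0 < b -> lca_closed Y ->
  x \in Y -> x \notin cuts Y b -> #|component Y (cuts Y b) x| < b.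
Proof.
move=> b0 cY xY xC; set C := cuts Y b; set K := component Y C x.
have cK : lca_closed K by apply: component_lca_closed.
have xK : x \in K by apply: component_refl.
have [t tK tmax] : exists2 t, t \in K & forall y, y \in K -> le y t.
  have [m [mK xm mmax]] := maximal_above xK.
  exists m => // y yK; have [z zK [yz mz _]] := cK _ _ yK mK.
  by rewrite -(mmax _ zK mz).
have /componentP[tY tC _] := tK.
have Ksub : K \subset below Y t.
  by apply/subsetP => y yK; rewrite inE tmax // andbT; case/componentP: yK.
have [t0|t0] := posnP (phi Y b t).
  apply: leq_ltn_trans (subset_leq_card Ksub) _.
  by move/eqP: t0; rewrite /phi -leqn0 leqNgt divn_gt0 // -ltnNge.
have [c [cC ct ec]] := cut_below tY t0.
have dis : K \subset below Y t :\: below Y c.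
  apply/subsetP => y yK; rewrite inE (subsetP Ksub _ yK) andbT inE.
  have /componentP[yY yC _] := yK; rewrite yY /=; apply/negP => yc.
  have /componentP[_ _ /(_ _ cC)] : t \in component Y C y by rewrite (component_eq yK).
  by rewrite le_btw.
apply: leq_ltn_trans (subset_leq_card dis) _.
rewrite cardsD (setIidPr _) ?below_mono //.
have h1 := leq_divM #|below Y c| b; have h2 := ltn_ceil #|below Y t| b0.
rewrite mulSn -/(phi Y b t) -/(phi Y b c) ec in h1 h2.
by move: (phi Y b t * b) h1 h2 => p; clear -b0; lia.
Qed.

(** The vertices of [C] visible from [u]; for [u] in [C] this is [u] alone. *)
Definition border (C : {set X}) (u : X) : {set X} :=
  [set r in C | [forall c in C, btw u c r ==> (c == r)]].

Lemma borderP (C : {set X}) u r :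
  reflect (r \in C /\ forall c, c \in C -> btw u c r -> c = r) (r \in border C u).
Proof.
rewrite inE; apply: (iffP andP) => -[rC h]; split=> //.
  by move=> c cC uc; apply/eqP; have /implyP := forall_inP h _ cC; apply.
by apply/forall_inP => c cC; apply/implyP => /(h _ cC) ->.
Qed.

Lemma border_exists (C : {set X}) u r : r \in C ->
  exists2 r', r' \in border C u & btw u r' r.
Proof.
move=> rC; pose P r' := (r' \in C) && btw u r' r.
have Pr : P r by rewrite /P rC btw_r.
case: (arg_minnP (fun z => #|[set c in C | btw u c z]|) Pr) => z /andP[zC uzr] zmin.
exists z => //; apply/borderP; split=> // c cC ucz; apply/eqP/negPn/negP => ncz.
have := zmin c; rewrite /P cC (btw_tr ucz uzr) => /(_ isT); apply/negP.
rewrite -ltnNge; apply: proper_card; apply/properP; split.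
  by apply/subsetP => y; rewrite !inE => /andP[-> /btw_tr]; apply.
exists z; rewrite !inE zC ?btw_r //=; apply/negP => uzc.
by have /btwuu e := btw_trr uzc ucz; rewrite e eqxx in ncz.
Qed.

Lemma border_up (C : {set X}) u r r' :
  r \in border C u -> r' \in border C u -> le u r -> le u r' -> r = r'.
Proof.
wlog rr : r r' / le r r' => [wl h h' ur ur'|].
  have [rr|rr] := le_chain ur ur'; first exact: wl.
  by apply/esym/wl.
by move=> /borderP[rC _] /borderP[_ h] ur ur'; apply: h => //; apply: le_btw.
Qed.

Lemma nle_btw u z w : le w z -> ~~ le u z -> btw u z w.
Proof.
move=> wz uz; apply/btwP => r; split=> [ur wr|zr]; last by right; apply: le_tr zr.
by have [//|rz] := le_chain wz wr; rewrite (le_tr ur rz) in uz.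
Qed.

(** The lowest common ancestor of [r] and [r'] is in [C] and lies on the path from [u] to one of
    them, so it equals that one by visibility; it then also blocks the view of the other. *)
Lemma border_down (C : {set X}) u r r' : lca_closed C ->
  r \in border C u -> r' \in border C u -> ~~ le u r -> ~~ le u r' -> r = r'.
Proof.
move=> cC rB r'B ur ur'; have /borderP[rC h] := rB; have /borderP[r'C h'] := r'B.
have [z zC zl] := cC _ _ rC r'C; case: (zl) => rz r'z zmin.
have [|e] := btw_split u (lca_btw zl).
  rewrite btwC => /(h _ zC) ez; rewrite ez in r'z.
  by apply: h' => //; apply: nle_btw.
have ez := h' _ zC e; rewrite ez in rz.
by apply/esym/h => //; apply: nle_btw.
Qed.

(** One border vertex may be an ancestor of [u], and one may be a vertex that is not. *)
Lemma card_border (C : {set X}) u : lca_closed C -> #|border C u| <= 2.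
Proof.
move=> cC; rewrite -(cardsID [set r | le u r] (border C u)).
apply: (@leq_add _ _ 1 1); apply/card_le1_eqP => r r'.
  move=> /setIP[rB]; rewrite in_set => ur /setIP[r'B]; rewrite in_set => ur'.
  exact: (@border_up C u).
move=> /setDP[rB]; rewrite in_set => ur /setDP[r'B]; rewrite in_set => ur'.
exact: (@border_down C u).
Qed.

(** At most [n] steps, each advancing along the tree path to [l]; such walks never turn back, so
    tree distances add up along them. *)
Fixpoint btw_walk (lk : X -> X -> Prop) (n : nat) (r l : X) : Prop :=
  if n is n'.+1 then r = l \/ exists z, [/\ lk r z, btw r z l & btw_walk lk n' z l]
  else r = l.

Lemma btw_walk_refl lk n r : btw_walk lk n r r.
Proof. by case: n => [|n] //=; left. Qed.

Lemma btw_walk_leq lk n m r l : n <= m -> btw_walk lk n r l -> btw_walk lk m r l.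
Proof.
elim: n m r => [|n IHn] [|m] r //= nm; first by left.
case=> [->|[z [rz b w]]]; first by left.
by right; exists z; split=> //; apply: IHn w.
Qed.

Lemma btw_walk_sub (lk lk' : X -> X -> Prop) n r l :
  (forall x y, lk x y -> x = y \/ lk' x y) -> btw_walk lk n r l -> btw_walk lk' n r l.
Proof.
move=> h; elim: n r => [|n IHn] r //= [->|[z [rz b w]]]; first by left.
have [->|rz'] := h _ _ rz; last by right; exists z; split=> //; apply: IHn.
exact/(@btw_walk_leq _ n n.+1 z l)/IHn.
Qed.

Lemma btw_walk_cat lk n m r z l : btw r z l ->
  btw_walk lk n r z -> btw_walk lk m z l -> btw_walk lk (n + m) r l.
Proof.
move=> rzl; elim: n r rzl => [|n IHn] r rzl /= => [-> //|[->|[y [ry b w]]]] w'.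
  by apply: (@btw_walk_leq _ m (n + m).+1 z l) => //; rewrite -addSn leq_addl.
right; exists y; split=> //; first exact: btw_tr b rzl.
by apply: IHn => //; apply: btw_trr b rzl.
Qed.

End TreeOrder.

(** * Shortcutting a tree *)

Section Spanner.
Variables (X : finType) (le : rel X).
Hypothesis le_tree : tree_order le.

Let lexx : reflexive le. Proof. by case: le_tree. Qed.
Let le_anti x y : le x y -> le y x -> x = y.
Proof. by case: le_tree => _ + _ _ _ xy yx => /(_ x y); rewrite xy yx; apply. Qed.
Let le_tr y x z : le x y -> le y z -> le x z.
Proof. by case: le_tree => _ _ + _ _; apply. Qed.
Let le_chain x y z : le x y -> le x z -> le y z \/ le z y.
Proof. by case: le_tree => _ _ _ h _ xy xz; apply/orP/(h x). Qed.

Notation link := (X * X * X)%type.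
Notation btw := (btw le).
Notation below := (below le).
Notation btw_walk := (btw_walk le).

(** The path between the two ends enters or leaves the subtree of its vertex [d.2], whose diameter
    will pay for a detour to a host in that subtree. *)
Definition link_ok (d : link) : Prop :=
  btw d.1.1 d.2 d.1.2 /\ le d.1.1 d.2 != le d.1.2 d.2.

Definition linked (D : {set link}) (x y : X) : Prop :=
  exists q, (x, y, q) \in D \/ (y, x, q) \in D.

Definition capacity (Y : {set X}) (h : nat) (D : {set link}) : Prop :=
  forall r, #|[set d in D | le d.2 r]| <= h * #|below Y r|.

(* The link (x, y, q) stands for a path x - host - y through a vertex still to be
   chosen anywhere below q; [capacity] is Hall's condition for hosting at most h
   links at each vertex of Y. *)
Record skeleton (Y : {set X}) (n h : nat) (H : X -> {set X}) (D : {set link}) : Prop :=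
  Skeleton {
    sk_deg : forall u, #|H u| <= h;
    sk_sub : forall u v, v \in H u -> u \in Y /\ v \in Y;
    sk_ok : forall d, d \in D -> link_ok d;
    sk_cap : capacity Y h D;
    sk_conn : forall u v, u \in Y -> v \in Y ->
      exists r l, [/\ r \in u |: H u, l \in v |: H v, btw u r v, btw r l v
                    & btw_walk (linked D) n r l] }.

Definition has_skeleton Y n h := exists H D, skeleton Y n h H D.

(* A skeleton on the cut vertices, with its heavy edges already counted as links. *)
Record core (C : {set X}) (n h : nat) (H : X -> {set X}) (D : {set link}) : Prop :=
  Core {
    co_deg : forall u, #|H u| <= h;
    co_sub : forall u v, v \in H u -> u \in C /\ v \in C;
    co_ok : forall d, d \in D -> link_ok d;
    co_cap : capacity C h D;
    co_conn : forall u v, u \in C -> v \in C ->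
      btw_walk (fun x y => [\/ linked D x y, y \in H x | x \in H y]) n u v }.

Definition has_core C n h := exists H D, core C n h H D.

Lemma has_skeleton_leq Y n n' h h' : n <= n' -> h <= h' ->
  has_skeleton Y n h -> has_skeleton Y n' h'.
Proof.
move=> nn hh [H [D [s1 s2 s3 s4 s5]]]; exists H, D; split=> //.
- by move=> u; apply: leq_trans hh.
- by move=> r; apply: leq_trans (s4 r) _; rewrite leq_mul2r hh orbT.
move=> u v uY vY; have [r [l [h1 h2 h3 h4 h5]]] := s5 _ _ uY vY.
by exists r, l; split=> //; apply: btw_walk_leq nn h5.
Qed.

(** The heavy edges at the two ends of a path become two more steps. *)
Lemma skeleton_core Y n h : has_skeleton Y n h -> has_core Y n.+2 h.
Proof.
case=> H [D [s1 s2 s3 s4 s5]]; exists H, D; split=> // u v uY vY.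
have [r [l [ru lv b1 b2 w]]] := s5 _ _ uY vY.
have w1 : btw_walk (fun x y => [\/ linked D x y, y \in H x | x \in H y]) n r l.
  by apply: btw_walk_sub w => x y; right; apply: Or31.
have w2 : btw_walk (fun x y => [\/ linked D x y, y \in H x | x \in H y]) n.+1 r v.
  rewrite -addn1; apply: btw_walk_cat w1 _ => //.
  move: lv; rewrite in_setU1 => /orP[/eqP->|lv]; first exact: btw_walk_refl.
  right; exists v; split=> //; [exact: Or33|exact: btw_r].
move: ru; rewrite in_setU1 => /orP[/eqP e|ru].
  by rewrite e in w2; apply: btw_walk_leq w2.
by right; exists r; split=> //; apply: Or32.
Qed.

Lemma complete_core (C : {set X}) : has_core C 1 #|C|.
Proof.
exists (fun u => if u \in C then C else set0), set0; split=> //.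
- by move=> u; case: ifP; rewrite ?cards0.
- by move=> u v; case: ifP; rewrite ?inE.
- by move=> d; rewrite inE.
- by move=> r; rewrite (_ : [set d in set0 | _] = set0) ?cards0 //; apply/setP => d; rewrite !inE.
move=> u v uC vC; right; exists v; split=> //; [by apply: Or32; rewrite uC|exact: btw_r].
Qed.

Lemma small_core (C : {set X}) : #|C| <= 1 -> has_core C 0 0.
Proof.
move=> /card_le1_eqP C1; exists (fun=> set0), set0; split=> //.
- by move=> u; rewrite cards0.
- by move=> u v; rewrite inE.
- by move=> d; rewrite inE.
- by move=> r; rewrite (_ : [set d in set0 | _] = set0) ?cards0 //; apply/setP => d; rewrite !inE.
by move=> u v uC vC /=; apply: C1.
Qed.

Lemma small_skeleton (Y : {set X}) : #|Y| <= 1 -> has_skeleton Y 0 0.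
Proof.
move=> /card_le1_eqP Y1; exists (fun=> set0), set0; split=> //.
- by move=> u; rewrite cards0.
- by move=> u v; rewrite inE.
- by move=> d; rewrite inE.
- by move=> r; rewrite (_ : [set d in set0 | _] = set0) ?cards0 //; apply/setP => d; rewrite !inE.
move=> u v uY vY; rewrite (Y1 u v uY vY); exists u, u.
by split; [exact: setU11|exact: setU11|exact: btw_l|exact: btw_l|exact: btw_walk_refl].
Qed.

(* Where the two-edge path replacing a heavy edge (z, c) of the cut vertices is
   hosted: below z itself unless c is below z, and otherwise below the first cut
   vertex q met when descending from z to c. *)
Lemma host_exists (C : {set X}) z c : z \in C -> c \in C -> c != z ->
  exists q, [/\ q \in C, link_ok (z, c, q) &
    q = z \/ [/\ q != z, le q z &
                forall q', q' \in C -> le q q' -> le q' z -> q' = q \/ q' = z]].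
Proof.
move=> zC cC cz; have [lcz|lcz] := boolP (le c z); last first.
  exists z; split=> //; last by left.
  by split=> /=; [apply: btw_l|rewrite lexx (negPf lcz)].
pose S := [set q in C | [&& le c q, le q z & q != z]].
have cS : c \in S by rewrite inE cC lexx lcz cz.
have [q [qS cq qmax]] := maximal_above le_tree cS.
move: (qS); rewrite inE => /and4P[qC _ qz nqz]; exists q; split=> //.
  split=> /=; first by rewrite btwC //; apply: le_btw.
  rewrite cq; apply/negP => /eqP zq; have := le_anti qz.
  by rewrite zq => /(_ isT) e; rewrite e eqxx in nqz.
right; split=> // q' q'C qq' q'z; have [->|nq'z] := eqVneq q' z; first by right.
by left; apply: qmax => //; rewrite inE q'C q'z nq'z (le_tr cq qq').
Qed.

Lemma leq_card_bigcup_imset (I J T : finType) (S : {set I}) (A : I -> {set J})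
    (f : I -> J -> T) m : (forall i, #|A i| <= m) ->
  #|\bigcup_(i in S) [set f i j | j in A i]| <= m * #|S|.
Proof.
move=> hA; apply: leq_trans (leq_card_bigcup _ _) _.
rewrite mulnC -sum_nat_const; apply: leq_sum => i _.
by rewrite (leq_trans (leq_imset_card _ _)) ?hA.
Qed.

(* A path between two pieces is u -> r ~ l <- v, where r and l are the cut vertices
   bordering the pieces of u and v; only these two edges are heavy. *)
Lemma one_level Y b n M h : lca_closed le Y -> 0 < b -> 6 * M <= b ->
  has_core (cuts le Y b) n M ->
  (forall x, x \in Y -> x \notin cuts le Y b ->
     has_skeleton (component le Y (cuts le Y b) x) n h) ->
  has_skeleton Y n h.+2.
Proof.
move=> cY b0 Mb [HC [DC [c1 c2 c3 c4 c5]]] hK; set C := cuts le Y b in c2 c4 c5 hK.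
have cC : lca_closed le C by apply: cuts_lca_closed.
have CY : C \subset Y by apply: cuts_sub.
(* One skeleton is fixed for each set [K], so that all vertices of a piece use the same one; sets
   without a skeleton get a dummy value. *)
have /choice[f fP] : forall K : {set X}, exists g : (X -> {set X}) * {set link},
    has_skeleton K n h -> skeleton K n h g.1 g.2.
  move=> K; have [[H [D s]]|no] := EM (has_skeleton K n h); first by exists (H, D).
  by exists (fun=> set0, set0).
have /choice[q qP] : forall e : X * X, exists q,
   e.1 \in C -> e.2 \in C -> e.2 != e.1 ->
   [/\ q \in C, link_ok (e, q) &
    q = e.1 \/ [/\ q != e.1, le q e.1 &
      forall q', q' \in C -> le q q' -> le q' e.1 -> q' = q \/ q' = e.1]].
  move=> [z c] /=; have [/and3P[zC cC' cz]|no] := boolP [&& z \in C, c \in C & c != z].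
    by have [q hq] := host_exists zC cC' cz; exists q.
  by exists z => z1 z2 z3; rewrite z1 z2 z3 in no.
pose K := component le Y C.
have KS x : x \in Y -> x \notin C -> skeleton (K x) n h (f (K x)).1 (f (K x)).2.
  by move=> xY xC; apply/fP/hK.
pose H u := if u \in Y then border le C u :|: (if u \notin C then (f (K u)).1 u else set0)
            else set0.
pose E := [set e : X * X | [&& e.1 \in C, e.2 \in HC e.1 & e.2 != e.1]].
pose DN : {set link} := [set (e, q e) | e in E].
pose DK : {set link} := \bigcup_(L in [set K x | x in Y :\: C]) (f L).2.
exists H, (DC :|: DN :|: DK); split.
- move=> u; rewrite /H; case: ifP => uY; last by rewrite cards0.
  apply: leq_trans (leq_card_setU _ _) _.
  rewrite -add2n leq_add ?card_border //; case: ifP => uC; last by rewrite cards0.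
  exact: sk_deg (KS _ uY uC) _.
- move=> u v; rewrite /H; case: ifP => uY; last by rewrite inE.
  rewrite in_setU => /orP[/borderP[/(subsetP CY)] //|].
  case: ifP => uC; last by rewrite inE.
  by move=> /(sk_sub (KS _ uY uC))[_ /componentP[]].
- move=> d; rewrite !in_setU => /orP[/orP[/c3//|]|].
    case/imsetP => -[z c]; rewrite inE /= => /and3P[zC cz ncz] ->.
    by have [] := qP (z, c) zC (c2 _ _ cz).2 ncz.
  case/bigcupP => L /imsetP[x]; rewrite inE => /andP[xC xY] -> dL.
  exact: sk_ok (KS _ xY xC) _ dL.
- move=> r.
  have capK : #|[set d in DK | le d.2 r]| <= h * #|below (Y :\: C) r|.
    pose P := [set K x | x in Y :\: C].
    have -> : [set d in DK | le d.2 r] = \bigcup_(L in P) [set d in (f L).2 | le d.2 r].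
      apply/setP => d; rewrite inE; apply/andP/bigcupP => [[/bigcupP[L LP dL] dr]|[L LP]].
        by exists L; rewrite // inE dL.
      by rewrite inE => /andP[dL dr]; split=> //; apply/bigcupP; exists L.
    apply: leq_trans (leq_card_bigcup _ _) _.
    apply: (@leq_trans (\sum_(L in P) h * #|below L r|)).
      apply: leq_sum => L /imsetP[x]; rewrite inE => /andP[xC xY] ->.
      exact: sk_cap (KS _ xY xC) r.
    rewrite -big_distrr /= leq_mul2l; apply/orP; right.
    rewrite -card_bigcup_disjoint.
      apply/subset_leq_card/bigcupsP => L /imsetP[x _ ->].
      by apply/subsetP => y; rewrite [y \in below (K x) r]inE => /andP[/componentP[yY yC _] yr];
         rewrite in_set in_setD yC yY.
    move=> i j /imsetP[x _ ->] /imsetP[y _ ->] ij; rewrite -setI_eq0; apply: contraR ij.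
    case/set0Pn => z /setIP[]; rewrite [z \in below (K x) r]inE [z \in below (K y) r]inE.
    by move=> /andP[/(component_eq le_tree) zx _] /andP[/(component_eq le_tree) zy _];
       apply/eqP; apply: etrans (esym zx) zy.
  have capN : #|[set d in DN | le d.2 r]| <= M * #|below C r| + M * #|below C r|.
    (* A new link of [z] is located at [z], or at a cut vertex [s] directly below [z] among the cut
       vertices. In the second case [z] is the next cut vertex above [s], hence determined by [s] as
       [nx s]. Each cut vertex is thus the location of at most [2 * M] new links. *)
    pose nb s z := [&& z != s, le s z &
      [forall q' in C, le s q' ==> le q' z ==> (q' == s) || (q' == z)]].
    pose nx s := odflt s [pick z in C | nb s z].
    have nxE s z : s \in C -> z \in C -> nb s z -> nx s = z.
      rewrite /nx => sC zC zs; case: pickP => [w /andP[wC ws]|/(_ z)]; last by rewrite /= zC zs.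
      wlog wz : z w sC zC wC zs ws / le w z => [wl|] /=.
        have /and3P[_ sz _] := zs; have /and3P[_ sw _] := ws.
        by have [wz|zw] := le_chain sw sz; [|apply/esym]; apply: wl.
      have /and3P[nws sw _] := ws; have /and3P[_ _ /forall_inP/(_ w wC)] := zs.
      by rewrite sw wz (negPf nws) => /eqP.
    have sub : [set d in DN | le d.2 r] \subset
        \bigcup_(z in below C r) [set (z, c, z) | c in HC z] :|:
        \bigcup_(s in below C r) [set (nx s, c, s) | c in HC (nx s)].
      apply/subsetP => d; rewrite inE => /andP[/imsetP[[z c]]]; rewrite inE /=.
      move=> /and3P[zC cz ncz] -> /= qr; have [_ cC'] := c2 _ _ cz.
      have [qC _ [/= qz|[/= nqz qz qmin]]] := qP (z, c) zC cC' ncz.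
        apply/setUP; left; apply/bigcupP; exists z; first by rewrite inE zC -{1}qz.
        by rewrite qz; apply/imsetP; exists c.
      apply/setUP; right; apply/bigcupP; exists (q (z, c)); first by rewrite inE qC.
      have nxq : nx (q (z, c)) = z.
        apply: nxE => //; rewrite /nb eq_sym nqz qz; apply/forall_inP => q' q'C.
        by apply/implyP => h1; apply/implyP => h2; have [->|->] := qmin _ q'C h1 h2;
           rewrite eqxx ?orbT.
      by rewrite nxq; apply/imsetP; exists c.
    apply: leq_trans (subset_leq_card sub) (leq_trans (leq_card_setU _ _) _).
    by rewrite leq_add //; apply: leq_card_bigcup_imset.
  have hC := card_cuts_below le_tree r b0 cY; rewrite -/C in hC.
  have hY : #|below Y r| = #|below C r| + #|below (Y :\: C) r|.
    rewrite -(cardsID C (below Y r)); congr (_ + _); apply: eq_card => x;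
      rewrite ?in_setI ?in_setD [x \in below Y r]in_set ?[x \in below C r]in_set
        ?[x \in below (_ :\: _) r]in_set ?in_setD.
      by have [/(subsetP CY)->|] := boolP (x \in C); rewrite ?andbT ?andbF.
    by rewrite andbA.
  have split3 : [set d in DC :|: DN :|: DK | le d.2 r] =
     [set d in DC | le d.2 r] :|: [set d in DN | le d.2 r] :|: [set d in DK | le d.2 r].
    by apply/setP => d; rewrite !in_set -!andb_orl.
  rewrite split3; apply: leq_trans (leq_card_setU _ _) _.
  apply: leq_trans (leq_add (leq_card_setU _ _) capK) _.
  apply: leq_trans (leq_add (leq_add (c4 r) capN) (leqnn _)) _.
  (* With [c] cut vertices and [k] other vertices below [r], old links, new links and links of the
     pieces number at most [M * c + 2 * M * c + h * k]. From [b * c <= 2 * (c + k)] and [6 * M <= b]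
     follows [3 * M * c <= c + k]. *)
  rewrite hY in hC *; move: hC Mb; clear.
  move: #|below C r| #|below (Y :\: C) r| => c k hC Mb.
  by nia.
move=> u v uY vY.
have lk x y : [\/ linked DC x y, y \in HC x | x \in HC y] ->
    x = y \/ linked (DC :|: DN :|: DK) x y.
  have [->|nxy] := eqVneq x y; first by left.
  case=> [[s hs]|yx|xy]; right.
  - by exists s; rewrite !in_setU; case: hs => ->; [left|right].
  - exists (q (x, y)); left; rewrite !in_setU; apply/orP; left; apply/orP; right.
    by apply/imsetP; exists (x, y); rewrite // inE /= (c2 _ _ yx).1 yx eq_sym.
  exists (q (y, x)); right; rewrite !in_setU; apply/orP; left; apply/orP; right.
  by apply/imsetP; exists (y, x); rewrite // inE /= (c2 _ _ xy).1 xy.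
(* Within one piece its own skeleton serves; otherwise some cut vertex lies on the path. *)
case: (boolP [&& u \notin C, v \notin C & v \in K u]) => [/and3P[uC vC vK]|huv].
  have Kv : K v = K u by apply: component_eq.
  have uK : u \in K u by apply: component_refl.
  have [r [l [ru lv b1 b2 w]]] := sk_conn (KS _ uY uC) uK vK.
  have hH x : x \in Y -> x \notin C -> {subset x |: (f (K x)).1 x <= x |: H x}.
    move=> xY xC y; rewrite /H xC xY !in_setU in_set1.
    by case/orP => [e|e]; apply/orP; [left|right; apply/orP; right].
  exists r, l; split=> //; [exact: (hH u)|by apply: (hH v); rewrite ?Kv|].
  apply: btw_walk_sub w => x y [s hs]; right; exists s; rewrite !in_setU.
  have sub d : d \in (f (K u)).2 -> d \in DK.
    by move=> dK; apply/bigcupP; exists (K u) => //; apply: imset_f; rewrite in_setD uC uY.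
  by case: hs => /sub ->; rewrite !orbT; [left|right].
have [c cC' bc] : exists2 c, c \in C & btw u c v.
  move: huv; have [uC _|uC] := boolP (u \in C); first by exists u => //; apply: btw_l.
  have [vC _|vC /= vK] := boolP (v \in C); first by exists v => //; apply: btw_r.
  have [/existsP[c /andP[cC' bc]]|/existsPn no] := boolP [exists c, (c \in C) && btw u c v].
    by exists c.
  case/negP: vK; apply/componentP; split=> // c cC'; apply/negP => bc.
  by have := no c; rewrite cC' bc.
(* [r] is a border vertex of [u] towards [c], and [l] one of [v] towards [r], so that [u], [r], [l],
   [v] occur in this order on the path. *)
have [r rB urc] := border_exists le_tree u cC'.
have /borderP[rC _] := rB.
have urv := btw_tr urc bc.
have [l lB vlr] := border_exists le_tree v rC.
have /borderP[lC _] := lB.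
exists r, l; split.
- by rewrite /H uY !in_setU rB orbT.
- by rewrite /H vY !in_setU lB orbT.
- by [].
- by rewrite btwC.
exact: btw_walk_sub lk (c5 _ _ rC lC).
Qed.

End Spanner.

(** * Ackermann recursion *)

Lemma ackA_double k x : 2 * x <= ackA k x.
Proof.
elim: k x => [|k IHk] x //=; elim: x => [//|x IHx] /=.
apply: leq_trans (IHk _); rewrite leq_mul2l /=.
case: x IHx => [//|x]; lia.
Qed.

Lemma ackA_exp k x : 2 ^ x <= ackA k.+1 x.
Proof.
elim: x => [//|x IHx]; apply: leq_trans (ackA_double k _).
by rewrite expnS leq_mul2l.
Qed.

Lemma ackB_exp k x : 2 ^ x.+1 <= ackB k.+1 x.
Proof.
suff dbl y : 1 < y -> 2 * y <= ackB k y.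
  elim: x => [//|x IHx]; rewrite expnS.
  apply: (leq_trans _ (dbl _ _)); first by rewrite leq_mul2l.
  by apply: leq_trans IHx; rewrite (@ltn_exp2l 2 0).
elim: k y => [|k IHk] y y1 /=; first by rewrite -mulnn leq_mul2r y1 orbT.
suff : 2 ^ y.+1 <= iter y (ackB k) 2.
  by apply: leq_trans; rewrite expnS leq_mul2l /= ltnW // ltn_expl.
elim: y {y1} => [//|y IHy] /=; apply: (leq_trans _ (IHk _ _)).
  by rewrite expnS leq_mul2l.
by apply: leq_trans IHy; rewrite (@ltn_exp2l 2 0).
Qed.

Lemma ackA1 x : ackA 1 x = 2 ^ x.
Proof. by elim: x => //= x ->; rewrite expnS. Qed.

Lemma ackB1 x : ackB 1 x = 2 ^ (2 ^ x).
Proof. by elim: x => //= x ->; rewrite -expnM expnS mulnC. Qed.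

(** For [y = n %/ 384] it suffices that [384 * 384 * y.+1 <= 2 ^ y], which starts to hold at
    [y = 22]. *)
Lemma exp_beats n : 22 * 384 <= n -> 384 * n <= 2 ^ (n %/ 384).
Proof.
move=> h; have : 22 <= n %/ 384 by rewrite leq_divRL.
have := ltn_ceil n (isT : 0 < 384); move: (n %/ 384) => y {h}.
move=> ny y22; apply: (@leq_trans (384 * (y.+1 * 384))).
  by rewrite leq_mul2l /= ltnW.
clear n ny; rewrite -(subnK y22); elim: (y - 22) => [|k IHk]; first by vm_compute.
rewrite addSn expnS; apply: leq_trans (leq_mul (leqnn 2) IHk); lia.
Qed.

Section Levels.
Variables (X : finType) (le : rel X).
Hypothesis le_tree : tree_order le.

Lemma tree_top (x0 : X) : exists t, forall x, le x t.
Proof.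
have [m [_ _ mmax]] := maximal_above le_tree (in_setT x0).
exists m => x; case: (le_tree) => _ _ _ _ /(_ x m)[z xz mz].
by rewrite -(mmax z (in_setT _) mz).
Qed.

Lemma card_all_cuts (Y : {set X}) b : 0 < b -> lca_closed le Y ->
  #|cuts le Y b| <= (2 * (#|Y| %/ b)).-1.
Proof.
move=> b0 cY; have [->|/set0Pn[x xC]] := eqVneq (cuts le Y b) set0; first by rewrite cards0.
have [t ht] := tree_top x.
have dnt (S : {set X}) : below le S t = S by apply/setP => y; rewrite in_set ht andbT.
have := @card_cuts _ _ le_tree Y b t b0 cY; rewrite /phi !dnt => h.
have : cuts le Y b != set0 by apply/set0Pn; exists x.
by move/h; lia.
Qed.

Lemma skeleton_step (Y : {set X}) b n M h : lca_closed le Y -> 0 < b -> 6 * M <= b ->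
  has_core le (cuts le Y b) n M ->
  (forall K : {set X}, lca_closed le K -> #|K| < b -> has_skeleton le K n h) ->
  has_skeleton le Y n h.+2.
Proof.
move=> cY b0 Mb hC hK; apply: one_level hC _ => // x xY xC; apply: hK.
  exact: component_lca_closed.
exact: card_component.
Qed.

(** Cutting with [b = 2 ^ s + 1] leaves at most one cut vertex, which needs no links, and pieces of
    at most half the bound; each round adds two heavy edges. *)
Lemma skeleton_log s (Y : {set X}) : lca_closed le Y -> #|Y| <= 2 ^ s ->
  has_skeleton le Y 0 (2 * s).
Proof.
elim: s Y => [|s IHs] Y cY hY; first exact: small_skeleton.
rewrite mulnS; apply: (@skeleton_step Y (2 ^ s).+1 0 0) => //.
apply: (small_core le); apply: leq_trans (card_all_cuts _ cY) _ => //.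
suff : #|Y| %/ (2 ^ s).+1 < 2 by lia.
by rewrite ltn_divLR //; apply: leq_ltn_trans hY _; rewrite expnS mulnS; lia.
Qed.

(** Cutting with [b = 16 * B] gives at most [2 * B] cut vertices, joined pairwise by single links,
    and [6 * 2 * B <= 16 * B]. Each round replaces [B ^ 2] by [B] in the size bound; the start
    [16 * 2 = 2 ^ 5] accounts for the summand 10. *)
Lemma skeleton_loglog s (Y : {set X}) : lca_closed le Y -> #|Y| <= 16 * 2 ^ (2 ^ s) ->
  has_skeleton le Y 1 (2 * s + 10).
Proof.
elim: s Y => [|s IHs] Y cY hY.
  by apply: has_skeleton_leq (@skeleton_log 5 Y cY _).
rewrite mulnS -addnA; set B := 2 ^ (2 ^ s) in IHs.
have B0 : 0 < B by rewrite expn_gt0.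
have hC : #|cuts le Y (16 * B)| <= 2 * B.
  apply: leq_trans (card_all_cuts _ cY) _; first by rewrite muln_gt0.
  apply: leq_trans (leq_pred _) _; rewrite leq_mul2l /=.
  rewrite -ltnS ltn_divLR ?muln_gt0 //; apply: leq_ltn_trans hY _.
  by rewrite expnS mul2n -addnn expnD -/B mulSn; lia.
apply: (@skeleton_step Y (16 * B) 1 (2 * B)) => //.
- by rewrite muln_gt0.
- by rewrite mulnA leq_mul2r orbT.
- have [H [D [c1 c2 c3 c4 c5]]] := complete_core le (cuts le Y (16 * B)).
  exists H, D; split=> // [u|r]; first exact: leq_trans hC.
  by apply: leq_trans (c4 r) _; rewrite leq_mul2r hC orbT.
by move=> K cK hK; apply: IHs => //; apply: ltnW.
Qed.

(* Two rounds of cutting bring the size from g N below N: the first leaves pieces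
   of size less than 384 N, and 384 N <= 2 ^ (N / 384) <= g (N / 384) makes those of
   the second smaller than 384 (N / 384), unless N is bounded and the logarithmic
   construction suffices. *)
Lemma skeleton_star n g i0 : 0 < i0 <= 2 -> (forall y, 2 ^ y <= g y) ->
  (forall Y y, lca_closed le Y -> #|Y| <= g y -> has_skeleton le Y n (64 * maxn 1 y)) ->
  forall s (Y : {set X}), lca_closed le Y -> #|Y| <= iter s g i0 ->
    has_skeleton le Y n.+2 (64 * maxn 1 s).
Proof.
move=> /andP[i1 i2] hg IH.
suff main s Y : lca_closed le Y -> #|Y| <= iter s g i0 ->
    has_skeleton le Y n.+2 (4 * s + 46).
  move=> s Y cY hY; have [s0|s0] := posnP s.
    rewrite s0 in hY *; apply: has_skeleton_leq (@skeleton_log 1 Y cY _) => //.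
    exact: leq_trans hY i2.
  apply: has_skeleton_leq (main s Y cY hY) => //.
  by rewrite (maxn_idPr s0); lia.
elim: s Y => [|s IHs] Y cY hY.
  apply: has_skeleton_leq (@skeleton_log 1 Y cY _) => //.
  exact: leq_trans hY i2.
rewrite /= in hY; set N := iter s g i0 in hY IHs.
have N0 : 0 < N.
  rewrite /N; case: s {IHs hY N} => [//|s] /=; apply: leq_trans (hg _).
  by rewrite expn_gt0.
(* The core on the cut vertices has degree at most [64 * y], so pieces of size
   [6 * 64 * y = 384 * y] are the smallest allowed. *)
have step Z y : 0 < y -> lca_closed le Z -> #|Z| <= g y ->
    has_core le (cuts le Z (384 * y)) n.+2 (64 * y).
  move=> y0 cZ hZ; apply: skeleton_core.
  rewrite -[y in 64 * y](maxn_idPr y0); apply: IH.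
    by apply: cuts_lca_closed; rewrite ?muln_gt0.
  exact: leq_trans (subset_leq_card (cuts_sub _ _ _)) hZ.
have -> : 4 * s.+1 + 46 = (4 * s + 48).+2 by lia.
apply: (@skeleton_step Y (384 * N) n.+2 (64 * N)) => //.
- by rewrite muln_gt0.
- by rewrite mulnA.
- exact: step.
move=> K cK hK; have [big|small] := leqP (22 * 384) N; last first.
  (* Here [384 * N <= 2 ^ 22], and 44 heavy edges fit into [4 * s + 48]. *)
  apply: has_skeleton_leq (@skeleton_log 22 K cK _) => //; first by lia.
  apply: leq_trans (ltnW hK) _.
  by apply: (@leq_trans (384 * (22 * 384))); [rewrite leq_mul2l ltnW|vm_compute].
have y0 : 0 < N %/ 384 by rewrite divn_gt0 // (leq_trans _ big).
have -> : 4 * s + 48 = (4 * s + 46).+2 by lia.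
apply: (@skeleton_step K (384 * (N %/ 384)) n.+2 (64 * (N %/ 384))) => //.
- by rewrite muln_gt0.
- by rewrite mulnA.
- apply: step => //; apply: leq_trans (ltnW hK) _.
  exact: leq_trans (exp_beats big) (hg _).
move=> L cL hL; apply: IHs => //; apply: leq_trans (ltnW hL) _.
by rewrite mulnC leq_divM.
Qed.

(** Two more links raise the Ackermann level by one, separately for even [l] with [ackA] and odd [l]
    with [ackB]. The induction starts from [ackA 1 s = 2 ^ s] with no link and
    [ackB 1 s = 2 ^ 2 ^ s] with one. *)
Lemma skeleton_ack l s (Y : {set X}) : lca_closed le Y ->
  #|Y| <= (if odd l then ackB else ackA) l./2.+1 s ->
  has_skeleton le Y l (64 * maxn 1 s).
Proof.
have [m] := ubnP l; elim: m => // m IHm in l s Y *; case: l => [|[|l]] hl cY.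
- move=> hY; have {}hY : #|Y| <= 2 ^ s by rewrite -ackA1.
  apply: has_skeleton_leq (skeleton_log cY hY) => //.
  by have := leq_maxr 1 s; lia.
- move=> hY; have {}hY : #|Y| <= 2 ^ (2 ^ s) by rewrite -ackB1.
  apply: has_skeleton_leq (@skeleton_loglog s Y cY _) => //.
    by have := leq_maxr 1 s; have := leq_maxl 1 s; lia.
  by apply: leq_trans hY _; rewrite leq_pmull.
have -> : odd l.+2 = odd l by rewrite /= negbK.
have IH Z y : lca_closed le Z -> #|Z| <= (if odd l then ackB else ackA) l./2.+1 y ->
    has_skeleton le Z l (64 * maxn 1 y).
  by apply: IHm; rewrite ltnS in hl; apply: ltnW.
case: ifP IH => _ IH /=.
  by apply: skeleton_star => //= y; apply: leq_trans (ackB_exp _ _); rewrite leq_exp2l.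
by apply: skeleton_star => //= y; apply: ackA_exp.
Qed.

Lemma skeleton_inv_ackermann l :
  has_skeleton le setT l (64 * maxn 1 (inv_ackermann l.+2 #|X|)).
Proof.
apply: skeleton_ack; first exact: lca_closedT.
rewrite cardsT /inv_ackermann /= negbK.
by case: ifP => _; case: ex_minnP.
Qed.

(* Greedy: a demand whose location is minimal can be served first. *)
Lemma host_assignment (T : finType) (loc : T -> X) (cap : X -> nat) (D : {set T}) :
  (forall r, #|[set d in D | le (loc d) r]| <= \sum_(x | le x r) cap x) ->
  exists f : T -> X, (forall d, d \in D -> le (f d) (loc d)) /\
    forall x, #|[set d in D | f d == x]| <= cap x.
Proof.
have [lexx _ le_tr le_ch _] := le_tree.
have le_anti x y : le x y -> le y x -> x = y.
  by case: le_tree => _ + _ _ _ xy yx => /(_ x y); rewrite xy yx; apply.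
have [m] := ubnP #|D|; elim: m => // m IHm in D cap * => hm hall.
have [->|/set0Pn[d1 d1D]] := eqVneq D set0.
  exists loc; split=> [d|x]; first by rewrite inE.
  by rewrite (_ : [set _ in _ | _] = set0) ?cards0 //; apply/setP => d; rewrite !inE.
case: (@arg_minnP _ d1 (mem D) (fun d => #|below le setT (loc d)|) d1D) => d0 /= d0D dmin.
have [x xd0 capx] : exists2 x, le x (loc d0) & 0 < cap x.
  have : 0 < \sum_(x | le x (loc d0)) cap x.
    apply: leq_trans (hall (loc d0)); rewrite card_gt0; apply/set0Pn.
    by exists d0; rewrite inE d0D lexx.
  rewrite lt0n sum_nat_eq0 negb_forall => /existsP[x].
  by rewrite negb_imply -lt0n => /andP[]; exists x.
pose cap' y := cap y - (y == x).
have [||f [f1 f2]] := IHm (D :\ d0) cap'.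
- by move: hm; rewrite (cardsD1 d0) d0D; lia.
- move=> r; have [xr|xr] := boolP (le x r); last first.
    rewrite (eq_bigr cap) => [|y yr]; last first.
      by rewrite /cap'; have [e|_] := eqVneq y x; [rewrite -e yr in xr|rewrite subn0].
    apply: leq_trans (hall r); apply: subset_leq_card; apply/subsetP => d.
    by rewrite !inE => /andP[/andP[_ ->]].
  have [dr|dr] := boolP (le (loc d0) r).
    have := hall r; rewrite (bigD1 x) //= (bigD1 x (F := cap')) //=.
    rewrite (cardsD1 d0) inE d0D dr /cap' eqxx subn1.
    rewrite [X in _ -> _ <= _ + X](eq_bigr cap) => [|y /andP[_ /negPf->]]; last by rewrite subn0.
    have -> : [set d in D | le (loc d) r] :\ d0 = [set d in D :\ d0 | le (loc d) r].
      by apply/setP => d; rewrite !inE andbA.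
    by move: capx; lia.
  (* Capacity was taken from below [r] but no demand was removed there. Since [r] and [loc d0] both
     lie above [x], [r] is then strictly below [loc d0], and by minimality of [loc d0] no demand is
     located below [r]. *)
  rewrite (_ : [set _ in _ | _] = set0) ?cards0 //; apply/setP => d; rewrite !inE.
  apply/negP => /andP[/andP[_ dD] ldr].
  have rd0 : le r (loc d0) by case/orP: (le_ch _ _ _ xd0 xr) => // h; rewrite h in dr.
  have := dmin _ dD; apply/negP; rewrite -ltnNge; apply: proper_card.
  apply/properP; split; first by apply: below_mono => //; apply: le_tr rd0.
  exists (loc d0); rewrite !inE //=; apply/negP => h.
  by rewrite (le_tr _ _ _ h ldr) in dr.
exists (fun d => if d == d0 then x else f d); split=> [d dD|y].
  have [->//|nd] := eqVneq d d0; apply: f1; rewrite !inE nd dD //.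
have [->|nyx] := eqVneq y x.
  apply: (@leq_trans #|d0 |: [set d in D :\ d0 | f d == x]|).
    apply: subset_leq_card; apply/subsetP => d; rewrite !inE.
    by have [//|nd] := eqVneq d d0 => /andP[-> ->].
  rewrite cardsU1; have := f2 x; rewrite /cap' eqxx.
  by case: (_ \notin _) => /=; move: capx; lia.
apply: leq_trans (leq_trans (f2 y) (leq_subr _ _)); apply: subset_leq_card.
apply/subsetP => d; rewrite !inE.
by have [_|nd] := eqVneq d d0 => /andP[-> //]; rewrite eq_sym (negPf nyx).
Qed.

End Levels.

Import Order.TTheory GRing.Theory Num.Theory.
Local Open Scope ring_scope.

(** * Walks and tree distances *)

Section Walks.
Variables (R : realType) (X : finType) (delta : X -> X -> R).
Hypothesis delta_metric : is_metric delta.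

Lemma delta_ge0 x y : 0 <= delta x y. Proof. by case: delta_metric. Qed.
Lemma deltaxx x : delta x x = 0. Proof. by case: delta_metric => _ /(_ x x)[_ ->]. Qed.
Lemma delta_eq0 x y : delta x y = 0 -> x = y.
Proof. by case: delta_metric => _ /(_ x y)[]. Qed.
Lemma deltaC x y : delta x y = delta y x. Proof. by case: delta_metric. Qed.
Lemma delta_tri y x z : delta x z <= delta x y + delta y z.
Proof. by case: delta_metric. Qed.

Definition reach (e : rel X) (n : nat) (u v : X) (c : R) : Prop :=
  exists p, [/\ path e u p, last u p = v, walk_length delta u p <= c & (size p <= n)%N].

Lemma walk_length_cat u p q : walk_length delta u (p ++ q) =
  walk_length delta u p + walk_length delta (last u p) q.
Proof. by rewrite /walk_length pairmap_cat big_cat. Qed.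

Lemma reach_refl e n u c : 0 <= c -> reach e n u u c.
Proof. by exists [::]; split; rewrite // /walk_length big_nil. Qed.

Lemma reach1 (e : rel X) u v c : e u v -> delta u v <= c -> reach e 1 u v c.
Proof.
by move=> uv c_ge; exists [:: v]; split; rewrite /= ?uv // /walk_length big_seq1.
Qed.

Lemma reach_leq e n m u v c c' : (n <= m)%N -> c <= c' ->
  reach e n u v c -> reach e m u v c'.
Proof.
move=> nm cc [p [h1 h2 h3 h4]]; exists p; split=> //; first exact: le_trans cc.
exact: leq_trans nm.
Qed.

Lemma reach_cat e n m u z v c c' :
  reach e n u z c -> reach e m z v c' -> reach e (n + m) u v (c + c').
Proof.
move=> [p [h1 h2 h3 h4]] [q [k1 k2 k3 k4]]; exists (p ++ q); split.
- by rewrite cat_path h1 h2.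
- by rewrite last_cat h2.
- by rewrite walk_length_cat h2 lerD.
by rewrite size_cat leq_add.
Qed.

Lemma reach_sub (e e' : rel X) n u v c : (forall x y, e x y -> x = y \/ e' x y) ->
  reach e n u v c -> reach e' n u v c.
Proof.
move=> ee' [p [h1 h2 h3 h4]].
elim: p n u c h1 h2 h3 h4 => [|y p IHp] n u c /=.
  move=> _ -> h3 _; apply: reach_refl; by rewrite /walk_length big_nil in h3.
case: n => // n /andP[uy yp] lp; rewrite /walk_length /= big_cons => hc sp.
have [e0|uy'] := ee' _ _ uy.
  apply: (@reach_leq _ n n.+1 u v c c) => //; apply: IHp; rewrite ?e0 //.
  by rewrite e0 deltaxx add0r in hc.
have w : reach e' n y v (c - delta u y).
  by apply: IHp => //; rewrite lerBrDl.
have := reach_cat (reach1 uy' (lexx _)) w.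
by apply: reach_leq; rewrite ?add1n // addrC subrK.
Qed.

End Walks.

(** * Tree distances and the cost of hosted links *)

Section TreeSpanner.
Variables (R : realType) (X : finType) (delta : X -> X -> R).
Hypothesis delta_metric : is_metric delta.
Variables (le : rel X) (w dg : X -> R).
Hypothesis le_tree : tree_order le.

Let lexx' : reflexive le. Proof. by case: le_tree. Qed.

(** [f r] is the weight of the edge from [r] to its parent; this edge is on the path when exactly
    one end lies in the subtree of [r]. *)
Definition tree_dist (f : X -> R) (u v : X) : R := \sum_(r | le u r != le v r) f r.

Lemma tree_distC f u v : tree_dist f u v = tree_dist f v u.
Proof. by apply: eq_bigl => r; rewrite eq_sym. Qed.

Lemma tree_dist_btw f u z v : btw le u z v ->
  tree_dist f u v = tree_dist f u z + tree_dist f z v.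
Proof.
move=> /btwP h; rewrite /tree_dist [LHS]big_mkcond [X in _ = X + _]big_mkcond.
rewrite [X in _ = _ + X]big_mkcond -big_split /=; apply: eq_bigr => r _; have := h r.
case: (le u r); case: (le v r); case: (le z r); rewrite /= ?addr0 ?add0r //=.
  by case=> /(_ isT isT).
by case=> _ /(_ isT) [].
Qed.

Hypothesis w_ge0 : forall r, 0 <= w r.
Hypothesis dg_ge0 : forall r, 0 <= dg r.
Hypothesis w_dist : forall u v, delta u v <= tree_dist w u v.
Hypothesis dg_diam : forall r x y, le x r -> le y r -> delta x y <= dg r.

(** Each edge is charged twice the bound on the diameter of the subtree under it, besides its
    weight. Being a tree distance, the cost is additive along a path. *)
Definition cost := tree_dist (fun r => w r + 2 * dg r).

Lemma tree_dist_ge0 f u v : (forall r, 0 <= f r) -> 0 <= tree_dist f u v.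
Proof. by move=> f0; apply: sumr_ge0. Qed.

Lemma delta_cost u v : delta u v <= cost u v.
Proof.
apply: le_trans (w_dist u v) _; apply: ler_sum => r _.
by rewrite lerDl mulr_ge0.
Qed.

(* The detour through the host x is paid by the term 2 * dg q of the cost. *)
Lemma cost_host u q v x : btw le u q v -> le u q != le v q -> le x q ->
  delta u x + delta x v <= cost u v.
Proof.
wlog uq : u v / le u q => [wl b ne xq|].
  have [uq|uq] := boolP (le u q); first exact: wl.
  have vq : le v q by move: ne; rewrite (negPf uq); case: (le v q).
  rewrite addrC /cost tree_distC (deltaC delta_metric x v) (deltaC delta_metric u x).
  by apply: wl => //; [rewrite btwC|rewrite eq_sym].
move=> b; rewrite uq /= => vq xq.
have dux : delta u x <= dg q by apply: dg_diam.
have dxq : delta x q <= dg q by apply: dg_diam.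
have dqv := w_dist q v; have dxv := delta_tri delta_metric q x v.
rewrite /cost (tree_dist_btw _ b).
have ge0 r : 0 <= w r + 2 * dg r by rewrite addr_ge0 // mulr_ge0.
have c1 := tree_dist_ge0 u q ge0.
(* As [v] is not below [q], the edge above [q] is on the path from [q] to [v]. *)
have c2 : tree_dist w q v + 2 * dg q <= tree_dist (fun r => w r + 2 * dg r) q v.
  rewrite /tree_dist (bigD1 q) /=; last by rewrite lexx'.
  rewrite [leRHS](bigD1 q) /=; last by rewrite lexx'.
  rewrite addrAC lerD2l; apply: ler_sum => r _; by rewrite lerDl mulr_ge0.
move: c1 c2 dqv; set W := tree_dist w q v; set A := tree_dist _ u q.
set B := tree_dist _ q v; move: dux dxq dxv; clear => *; lra.
Qed.

(** A vertex owns at most [h] heavy edges and the two edges of each of at most [h] links it hosts,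
    which gives [192 = 3 * 64]. A path uses [l] links of two hops and two heavy edges. *)
Lemma tree_spanner l : exists out : X -> {set X},
  (forall u, #|out u| <= 192 * maxn 1 (inv_ackermann l.+2 #|X|))%N /\
  forall u v, reach delta (fun x y => [|| x == y, y \in out x | x \in out y])
                (2 * l + 2) u v (cost u v).
Proof.
have [H [D [s1 _ s3 s4 s5]]] := skeleton_inv_ackermann le_tree l.
set h := (64 * _)%N in s1 s4.
have [|f [f1 f2]] := @host_assignment _ _ le_tree _ (fun d : X * X * X => d.2) (fun=> h) D.
  move=> r; apply: leq_trans (s4 r) _; rewrite sum_nat_const mulnC leq_mul2r.
  by apply/orP; right; apply: subset_leq_card; apply/fintype.subsetP => x; rewrite !inE.
pose hosted u := [set d in D | f d == u].
pose out u := H u :|: ([set d.1.1 | d in hosted u] :|: [set d.1.2 | d in hosted u]).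
exists out; split=> [u|u v].
  rewrite /out; apply: leq_trans (leq_card_setU _ _) _.
  apply: leq_trans (leq_add (s1 u) (leq_card_setU _ _)) _.
  apply: leq_trans (leq_add (leqnn _) (leq_add (leq_imset_card _ _) (leq_imset_card _ _))) _.
  have := f2 u; rewrite /= -/(hosted u) (_ : 192 = 3 * 64)%N // -mulnA -/h.
  by move: #|hosted u| (h) => a b; clear; lia.
set e : rel X := fun x y => _.
have heavy x r : r \in x |: H x -> reach delta e 1 x r (cost x r).
  move=> xr; apply: reach1; last exact: delta_cost.
  rewrite /e; move: xr; rewrite finset.in_setU1 => /orP[/eqP->|xr]; first by rewrite eqxx.
  by rewrite /out finset.in_setU xr /= orbT.
have heavy' x r : r \in x |: H x -> reach delta e 1 r x (cost r x).
  move=> xr; apply: reach1; last exact: delta_cost.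
  rewrite /e; move: xr; rewrite finset.in_setU1 => /orP[/eqP->|xr]; first by rewrite eqxx.
  by rewrite /out !finset.in_setU xr /= !orbT.
have light d : d \in D -> reach delta e 2 d.1.1 d.1.2 (cost d.1.1 d.1.2) /\
    reach delta e 2 d.1.2 d.1.1 (cost d.1.2 d.1.1).
  move=> dD; have [b ne] := s3 d dD; have fq := f1 d dD; split.
    apply: (reach_leq (leqnn 2) (cost_host b ne fq)).
    apply: (@reach_cat _ _ _ _ 1 1 _ (f d)); apply: reach1 => //.
      rewrite /e /out; apply/or3P/Or33; rewrite !finset.in_setU; apply/orP; right; apply/orP; left.
      by apply/imsetP; exists d; rewrite // inE dD eqxx.
    rewrite /e /out; apply/or3P/Or32; rewrite !finset.in_setU; apply/orP; right; apply/orP; right.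
    by apply/imsetP; exists d; rewrite // inE dD eqxx.
  rewrite btwC in b; rewrite eq_sym in ne.
  apply: (reach_leq (leqnn 2) (cost_host b ne fq)).
  apply: (@reach_cat _ _ _ _ 1 1 _ (f d)); apply: reach1 => //.
    rewrite /e /out; apply/or3P/Or33; rewrite !finset.in_setU; apply/orP; right; apply/orP; right.
    by apply/imsetP; exists d; rewrite // inE dD eqxx.
  rewrite /e /out; apply/or3P/Or32; rewrite !finset.in_setU; apply/orP; right; apply/orP; left.
  by apply/imsetP; exists d; rewrite // inE dD eqxx.
have cost_ge0 x y : 0 <= cost x y by apply: le_trans (delta_ge0 _ _ _) (delta_cost _ _).
have walk n r z : btw_walk le (linked D) n r z -> reach delta e (2 * n) r z (cost r z).
  elim: n r => [|n IHn] r /=; first by move->; apply: reach_refl.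
  case=> [->|[y [[q hq] b wy]]]; first exact: reach_refl.
  rewrite mulnS /cost (tree_dist_btw _ b); apply: (@reach_cat _ _ _ _ _ _ _ y).
    by case: hq => /light[].
  exact: IHn.
have [r [z [ur vz b1 b2 wk]]] := s5 u v (finset.in_setT u) (finset.in_setT v).
rewrite /cost (tree_dist_btw _ b1) (tree_dist_btw _ b2).
have -> : (2 * l + 2 = 1 + (2 * l + 1))%N by lia.
apply: reach_cat (heavy _ _ ur) _.
exact: reach_cat (walk _ _ _ wk) (heavy' _ _ vz).
Qed.

End TreeSpanner.

(** * Trees from hierarchies of clusters *)

(* L i p is the leader of the level-i cluster of p, and Dm i bounds the diameter
   of the level-i clusters. *)
Record leader_system (R : realType) (X : finType) (delta : X -> X -> R)
    (L : nat -> X -> X) (h : nat) (Dm : nat -> R) : Prop := LeaderSystem {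
  ls_0 : forall p, L 0 p = p;
  ls_max : forall i j p, L i (L j p) = L (maxn i j) p;
  ls_top : forall p q, L h p = L h q;
  ls_diam : forall i p q, L i p = L i q -> delta p q <= Dm i;
  ls_geom : forall i, 2 * Dm i <= Dm i.+1 }.

Section LeaderTree.
Variables (R : realType) (X : finType) (delta : X -> X -> R).
Hypothesis delta_metric : is_metric delta.
Variables (L : nat -> X -> X) (h : nat) (Dm : nat -> R).
Hypothesis L_sys : leader_system delta L h Dm.
Hypothesis Dm_ge0 : forall i, 0 <= Dm i.

Let L0 := ls_0 L_sys.
Let LL := ls_max L_sys.
Let Lh := ls_top L_sys.
Let diam := ls_diam L_sys.
Let geom := ls_geom L_sys.

Definition leader_le : rel X := fun p q => `[< exists i, L i p = q >].
Notation le := leader_le.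

Lemma leader_leP p q : reflect (exists i, L i p = q) (le p q).
Proof. exact: asboolP. Qed.

Lemma leader_tree_order : tree_order le.
Proof.
split.
- by move=> p; apply/leader_leP; exists 0%N.
- move=> p q /andP[/leader_leP[i pq] /leader_leP[j qp]].
  have [ji|/ltnW ij] := leqP j i.
    by rewrite -{1}qp -pq LL (maxn_idPr ji).
  by rewrite -[RHS]pq -{2}qp LL (maxn_idPr ij) qp.
- move=> q p r /leader_leP[i <-] /leader_leP[j <-].
  by apply/leader_leP; exists (maxn j i); rewrite LL.
- move=> p q r /leader_leP[i <-] /leader_leP[j <-].
  have [ij|/ltnW ji] := leqP i j; apply/orP; [left|right]; apply/leader_leP.
    by exists j; rewrite LL (maxn_idPl ij).
  by exists i; rewrite LL (maxn_idPl ji).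
- by move=> p q; exists (L h p); apply/leader_leP; exists h => //; apply: Lh.
Qed.

(** [t] is the last level at which [r] leads its own cluster, so [L t.+1 r] is its parent in the
    tree. *)
Definition at_level (t : nat) (r : X) : bool := (L t r == r) && (L t.+1 r != r).

Lemma at_level_le t r x : at_level t r -> le x r = (L t x == r).
Proof.
move=> /andP[/eqP rt /eqP rt1]; apply/leader_leP/eqP => [[i xr]|<-]; last by exists t.
have [it|ti] := leqP i t.
  by rewrite -[RHS]rt -xr LL (maxn_idPl it).
by case: rt1; rewrite -xr LL (maxn_idPr ti).
Qed.

Lemma at_level_exists r : L h r != r -> exists2 t, (t < h)%N & at_level t r.
Proof.
move=> hr; have ex : exists t, L t r != r by exists h.
case: (ex_minnP ex) => -[|t]; first by rewrite L0 eqxx.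
move=> ht tmin; exists t; first exact: tmin.
rewrite /at_level ht andbT; apply/negPn/negP => /tmin; by rewrite ltnn.
Qed.

(** At most one level contributes: this is the distance from [r] to its parent, and 0 at the
    root. *)
Definition leader_weight (r : X) : R :=
  \sum_(t < h | at_level t r) delta r (L t.+1 r).
Definition leader_diam (r : X) : R :=
  \sum_(t < h | at_level t r) Dm t + (if L h r == r then Dm h else 0).

Lemma leader_weight_ge0 r : 0 <= leader_weight r.
Proof. by apply: sumr_ge0 => t _; apply: delta_ge0. Qed.

Lemma leader_diam_ge0 r : 0 <= leader_diam r.
Proof.
by rewrite addr_ge0 //; [apply: sumr_ge0|case: ifP].
Qed.

Lemma leader_diamP r x y : le x r -> le y r -> delta x y <= leader_diam r.
Proof.
move=> xr yr; rewrite /leader_diam; case: ifPn => [_|hr].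
  by apply: le_trans (diam (Lh x y)) _; rewrite lerDr sumr_ge0.
have [t th tr] := at_level_exists hr; rewrite addr0.
rewrite (bigD1 (Ordinal th)) //=; apply: le_trans (_ : Dm t <= _).
  by apply: diam; move: xr yr; rewrite !(at_level_le _ tr) => /eqP-> /eqP->.
by rewrite lerDl sumr_ge0.
Qed.

Lemma exchange_levels (P : pred X) (F : nat -> X -> R) :
  \sum_(r | P r) \sum_(t < h | at_level t r) F t r =
  \sum_(t < h) \sum_(r | P r && at_level t r) F t r.
Proof.
by rewrite (exchange_big_dep predT).
Qed.

(** Telescoping over the levels: while [L t u] and [L t v] differ, replacing both by their leaders
    at level [t.+1] costs at most the weights of the separating vertices of level [t]. *)
Lemma leader_weight_dist u v : delta u v <= tree_dist le leader_weight u v.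
Proof.
rewrite /tree_dist /leader_weight (exchange_levels _ (fun t r => delta r (L t.+1 r))).
pose T t := \sum_(r | (le u r != le v r) && at_level t r) delta r (L t.+1 r).
have T0 t : 0 <= T t by apply: sumr_ge0 => r _; apply: delta_ge0.
have step t : delta (L t u) (L t v) <= delta (L t.+1 u) (L t.+1 v) + T t.
  have [->|ne] := eqVneq (L t u) (L t v).
    by rewrite (deltaxx delta_metric) addr_ge0 // delta_ge0.
  set a := L t u in ne *; set b := L t v in ne *.
  have aE : L t.+1 a = L t.+1 u by rewrite /a LL (maxn_idPl _).
  have bE : L t.+1 b = L t.+1 v by rewrite /b LL (maxn_idPl _).
  have at_a : L t a == a by rewrite /a LL maxnn.
  have at_b : L t b == b by rewrite /b LL maxnn.
  pose F r := if (le u r != le v r) && at_level t r then delta r (L t.+1 r) else 0.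
  have F0 r : 0 <= F r by rewrite /F; case: ifP => // _; apply: delta_ge0.
  (* Since [a] and [b] differ, they are separate summands; one that remains leader at the next level
     does not move and has summand 0. *)
  have Ta : F a + F b <= T t.
    rewrite /T big_mkcond (bigD1 a) //= (bigD1 b) ?[b == a]eq_sym //= addrA lerDl.
    by apply: sumr_ge0 => r _; apply: F0.
  have Fa : delta a (L t.+1 u) <= F a.
    rewrite /F -aE; have [la|] := boolP (at_level t a).
      by rewrite !(at_level_le _ la) eqxx [_ == a]eq_sym (negPf ne).
    by rewrite /at_level at_a /= negbK andbF => /eqP->; rewrite (deltaxx delta_metric).
  have Fb : delta b (L t.+1 v) <= F b.
    rewrite /F -bE; have [lb|] := boolP (at_level t b).
      by rewrite !(at_level_le _ lb) eqxx (negPf ne).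
    by rewrite /at_level at_b /= negbK andbF => /eqP->; rewrite (deltaxx delta_metric).
  have t1 := delta_tri delta_metric (L t.+1 u) a b.
  have t2 := delta_tri delta_metric (L t.+1 v) (L t.+1 u) b.
  rewrite (deltaC delta_metric b) in Fb; move: Ta Fa Fb t1 t2; lra.
have main n : delta u v <= delta (L n u) (L n v) + \sum_(t < n) T t.
  elim: n => [|n IHn]; first by rewrite !L0 big_ord0 addr0.
  apply: le_trans IHn _; rewrite big_ord_recr /= [X in _ <= _ + X]addrC addrA lerD2r.
  exact: step.
by have := main h; rewrite (Lh u v) (deltaxx delta_metric) add0r.
Qed.

Lemma sum_two_terms_le (P : pred X) (F : X -> R) a b c : 0 <= c ->
  (forall r, P r -> r = a \/ r = b) -> (forall r, P r -> F r <= c) ->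
  \sum_(r | P r) F r <= 2 * c.
Proof.
move=> c0 Pab Fc; apply: (@le_trans _ _ (\sum_(r in [set a; b]%SET) c)).
  rewrite [leLHS]big_mkcond [leRHS]big_mkcond; apply: ler_sum => r _ /=.
  case: ifPn => [Pr|_]; last by case: ifP.
  rewrite finset.in_set2; have -> : (r == a) || (r == b).
    by case: (Pab _ Pr) => ->; rewrite eqxx ?orbT.
  exact: Fc.
rewrite sumr_const -[leLHS]mulr_natl ler_wpM2r // (ler_nat _ _ 2).
by rewrite cards2; case: (_ != _).
Qed.

(** Nothing separates [u] from [v] above level [j]. Levels below [j] form a geometric sum of at most
    [8 * Dm j]. At level [j], [L j u] stays leader, so the only edge starts at [L j v]; its length
    is at most [delta u v + 2 * Dm j], and its detour charge is [2 * Dm j]. *)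
Lemma leader_cost u v j : L j.+1 u = L j.+1 v -> L j u <> L j v -> L j.+1 u = L j u ->
  cost le leader_weight leader_diam u v <= delta u v + 12 * Dm j.
Proof.
move=> e1 ne e2.
have later t : (j < t)%N -> L t u = L t v.
  by move=> jt; rewrite -(maxn_idPl jt) -!LL e1.
have jh : (j < h)%N.
  rewrite ltnNge; apply/negP => hj; apply: ne.
  by rewrite -(maxn_idPl hj) -!LL (Lh u v).
pose G t := \sum_(r | (le u r != le v r) && at_level t r) (delta r (L t.+1 r) + 2 * Dm t).
have -> : cost le leader_weight leader_diam u v = \sum_(t < h) G t.
  rewrite /G -(exchange_levels (fun r => le u r != le v r)
                 (fun t r => delta r (L t.+1 r) + 2 * Dm t)).
  apply: eq_bigr => r sep; rewrite /leader_weight /leader_diam.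
  have -> : (L h r == r) = false.
    apply/negP => /eqP hr; case/negP: sep; apply/eqP.
    by transitivity true; [|symmetry]; apply/leader_leP; exists h; rewrite -hr; apply: Lh.
  by rewrite addr0 big_distrr -big_split.
have G_late t : (j < t)%N -> G t = 0.
  move=> jt; rewrite /G big_pred0 // => r; apply/negP => /andP[sep tr].
  by move: sep; rewrite !(at_level_le _ tr) (later _ jt) eqxx.
have Gcases t r : (le u r != le v r) && at_level t r -> r = L t u \/ r = L t v.
  move=> /andP[sep tr]; move: sep; rewrite !(at_level_le _ tr).
  have [|_] := eqVneq (L t u) r; first by left.
  by have [|_] := eqVneq (L t v) r; first by right.
have G_early t : (t < j)%N -> G t <= 4 * Dm t.+1.
  move=> tj; apply: (@le_trans _ _ (2 * (2 * Dm t.+1))); last by lra.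
  apply: (@sum_two_terms_le _ _ (L t u) (L t v)); [by rewrite mulr_ge0|exact: Gcases|].
  move=> r _; have : delta r (L t.+1 r) <= Dm t.+1.
    by apply: diam; rewrite LL maxnn.
  by have := geom t; lra.
have G_j : G j <= delta u v + 4 * Dm j.
  set a := L j u in ne e2; set b := L j v in ne.
  have bE : L j.+1 b = a by rewrite /b LL (maxn_idPl _) // -e1.
  have dab : delta b a <= delta u v + 2 * Dm j.
    have d1 : delta u a <= Dm j by apply: diam; rewrite /a LL maxnn.
    have d2 : delta b v <= Dm j by apply: diam; rewrite /b LL maxnn.
    have t1 := delta_tri delta_metric v b a.
    have t2 := delta_tri delta_metric u v a.
    rewrite (deltaC delta_metric v u) in t2; move: d1 d2 t1 t2; lra.
  rewrite /G; apply: (@le_trans _ _ (\sum_(r | r == b) (delta r (L j.+1 r) + 2 * Dm j))).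
    rewrite [leLHS]big_mkcond [leRHS]big_mkcond; apply: ler_sum => r _.
    case: ifPn => [sr|_]; last by case: ifP => _; rewrite // addr_ge0 ?mulr_ge0 // delta_ge0.
    have [ra|->] := Gcases _ _ sr; last by rewrite eqxx.
    move: sr; rewrite ra /at_level !LL maxnn (maxn_idPl (leqnSn j)) e2 eqxx.
    by rewrite !andbF.
  rewrite big_pred1_eq bE; move: dab; lra.
have geo n : \sum_(t < n) Dm t.+1 <= 2 * Dm n.
  elim: n => [|n IHn]; first by rewrite big_ord0 mulr_ge0.
  by rewrite big_ord_recr /=; have := geom n; move: IHn; lra.
rewrite -(big_mkord xpredT G) (big_cat_nat (n := j.+1)) //= big_nat_recr //=.
rewrite [X in _ + _ + X]big_nat_cond [X in _ + _ + X]big1 ?addr0; last first.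
  by move=> t /andP[/andP[jt _] _]; apply: G_late.
have s1 : \sum_(0 <= t < j) G t <= 8 * Dm j.
  rewrite big_mkord; apply: (@le_trans _ _ (\sum_(t < j) 4 * Dm t.+1)).
    by apply: ler_sum => t _; apply: G_early.
  by rewrite -big_distrr /=; have := geo j; lra.
move: s1 G_j; lra.
Qed.

Lemma leader_spanner l : exists out : X -> {set X},
  (forall u, #|out u| <= 192 * maxn 1 (inv_ackermann l.+2 #|X|))%N /\
  forall u v j, L j.+1 u = L j.+1 v -> L j u <> L j v -> L j.+1 u = L j u ->
    reach delta (fun x y => [|| x == y, y \in out x | x \in out y])
      (2 * l + 2) u v (delta u v + 12 * Dm j).
Proof.
have [out [h1 h2]] := tree_spanner delta_metric leader_tree_order leader_weight_ge0
  leader_diam_ge0 leader_weight_dist leader_diamP l.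
exists out; split=> // u v j e1 e2 e3.
exact: reach_leq (leqnn _) (leader_cost e1 e2 e3) (h2 u v).
Qed.

End LeaderTree.

(** * Nets and colourings *)

Section Nets.
Variables (R : realType) (X : finType) (delta : X -> X -> R).
Hypothesis delta_metric : is_metric delta.

Definition separated (s : R) (N : {set X}) : bool :=
  [forall x in N, forall y in N, (x != y) ==> (s < delta x y)].

Lemma separatedP s (N : {set X}) :
  reflect (forall x y, x \in N -> y \in N -> x <> y -> s < delta x y) (separated s N).
Proof.
apply: (iffP forall_inP) => h x; last first.
  move=> xN; apply/forall_inP => y yN; apply/implyP => /eqP; exact: h.
move=> y xN yN /eqP xy; have := h x xN => /forall_inP/(_ y yN)/implyP; exact.
Qed.

(** Halving the radius [t] times gives balls of radius at most [s / 2], which contain at most one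
    point of [S] each. *)
Lemma packing (d s : R) t (r : R) x (S : {set X}) : is_doubling delta d -> 0 < r ->
  separated s S -> (forall y, y \in S -> delta x y <= r) -> 2 * r <= 2 ^+ t * s ->
  #|S|%:R <= (2 `^ d) ^+ t :> R.
Proof.
move=> dd; elim: t r x S => [|t IHt] r x S r0 sS Sr h.
  rewrite expr0 (ler_nat _ _ 1); apply/card_le1_eqP => y z yS zS; apply/eqP.
  apply/negPn/negP => /eqP yz; have := separatedP _ _ sS _ _ zS yS yz.
  have := delta_tri delta_metric x z y; rewrite (deltaC delta_metric z x).
  have := Sr _ yS; have := Sr _ zS; rewrite expr0 mul1r in h; lra.
have [C hC cov] := dd x r r0.
have sub : S \subset \bigcup_(c in C) [set y in S | delta c y <= r / 2]%SET.
  apply/fintype.subsetP => y yS; have [c cC cy] := cov y (Sr y yS).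
  by apply/finset.bigcupP; exists c; rewrite // !inE yS.
apply: (@le_trans _ _ (\sum_(c in C) (2 `^ d) ^+ t)).
  have := leq_trans (subset_leq_card sub) (leq_card_bigcup _ _).
  rewrite -(ler_nat R) => /le_trans; apply.
  rewrite natr_sum; apply: ler_sum => c _; apply: (IHt (r / 2) c).
  - by rewrite divr_gt0.
  - apply/separatedP => y z; rewrite !inE => /andP[yS _] /andP[zS _].
    exact: (separatedP _ _ sS).
  - by move=> y; rewrite !inE => /andP[].
  - by move: h; rewrite exprS -mulrA; lra.
rewrite sumr_const -[leLHS]mulr_natl exprS ler_wpM2r // exprn_ge0 // powR_ge0 //.
Qed.

(** A separated set of largest size covers, since an uncovered point could be added to it. *)
Lemma net_exists (s : R) : 0 <= s ->
  exists N : {set X}, separated s N /\ forall x, exists2 y, y \in N & delta x y <= s.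
Proof.
move=> s0; have P0 : separated s finset.set0 by apply/separatedP => x y; rewrite inE.
case: (@arg_maxnP _ finset.set0 (separated s) (fun N : {set X} => #|N|) P0) => N sN Nmax.
exists N; split=> // x.
have [/existsP[y /andP[yN xy]]|/existsPn no] := boolP [exists y, (y \in N) && (delta x y <= s)].
  by exists y.
have far y : y \in N -> s < delta x y.
  by move=> yN; have := no y; rewrite yN /= -ltNge.
have xN : x \notin N.
  by apply/negP => /far; rewrite (deltaxx delta_metric) ltNge s0.
have : separated s (x |: N)%SET.
  apply/separatedP => y z; rewrite !finset.in_setU1 => /orP[/eqP->|yN] /orP[/eqP->|zN] // yz.
  - exact: far.
  - by rewrite (deltaC delta_metric); apply: far.
  - exact: (separatedP _ _ sN).
by move/Nmax; rewrite cardsU1 xN /= add1n ltnn.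
Qed.

(** Greedy colouring; [D] counts the point itself among its neighbours, so one of [D] colours is
    always free. *)
Lemma coloring_exists (r : R) (D : nat) (N : {set X}) : 0 <= r ->
  (forall x, x \in N -> #|[set y in N | (delta x y <= r)%R]%SET| <= D)%N ->
  exists chi : X -> nat, (forall x, x \in N -> (chi x < D)%N) /\
    forall x y, x \in N -> y \in N -> delta x y <= r -> chi x = chi y -> x = y.
Proof.
move=> r0; have [m] := ubnP #|N|; elim: m => // m IHm in N * => hm hN.
have [->|/finset.set0Pn[x xN]] := eqVneq N finset.set0.
  by exists (fun=> 0%N); split=> x; rewrite inE.
have [||chi [c1 c2]] := IHm (N :\ x)%SET.
- by move: hm; rewrite (cardsD1 x) xN; lia.
- move=> y; rewrite !inE => /andP[_ yN]; apply: leq_trans (hN y yN).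
  by apply: subset_leq_card; apply/fintype.subsetP => z; rewrite !inE => /andP[/andP[_ ->]].
pose nbr := [set y in N :\ x | delta x y <= r]%SET.
have hnbr : (#|nbr| < D)%N.
  apply: leq_trans (hN x xN); apply: proper_card; apply/properP; split.
    by apply/fintype.subsetP => z; rewrite !inE => /andP[/andP[_ ->]].
  by exists x; rewrite !inE ?xN ?(deltaxx delta_metric) // eqxx.
have [c cD cfree] : exists2 c, (c < D)%N & forall y, y \in nbr -> chi y != c.
  have [/hasP[c]|/hasPn no] := boolP (has (fun c => c \notin [seq chi y | y in nbr]) (iota 0 D)).
    rewrite mem_iota /= => cD nc; exists c => // y yn; apply/negP => /eqP e.
    by case/negP: nc; apply/fintype.imageP; exists y.
  have : (size (iota 0 D) <= size [seq chi y | y in nbr])%N.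
    by apply: uniq_leq_size (iota_uniq _ _) _ => c /no; rewrite negbK.
  by rewrite size_iota size_image leqNgt hnbr.
exists (fun y => if y == x then c else chi y); split=> [y yN|y z yN zN].
  have [_//|yx] := eqVneq y x; apply: c1; by rewrite !inE yx.
have [->|yx] := eqVneq y x; have [->|zx] := eqVneq z x => // yz e.
- by have := cfree z; rewrite !inE zx zN yz e eqxx => /(_ isT).
- by have := cfree y; rewrite !inE yx yN (deltaC delta_metric) yz e eqxx => /(_ isT).
- by apply: c2 => //; rewrite !inE ?yx ?zx.
Qed.

End Nets.

(** * Cluster hierarchies directed by two colours *)

Section Hierarchy.
Variables (R : realType) (X : finType) (delta : X -> X -> R).
Hypothesis delta_metric : is_metric delta.
Variables (s : nat -> R) (N : nat -> {set X}) (chi : nat -> X -> nat) (h : nat).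
Hypothesis s_gt0 : forall i, 0 < s i.
Hypothesis s_growth : forall i, 4 * s i <= s i.+1.
Hypothesis s_min : forall x y, x <> y -> s 0%N < delta x y.
Hypothesis s_max : forall x y, delta x y <= s h.
Hypothesis N_sep : forall i, separated delta (s i) (N i).
Hypothesis N_cov : forall i x, exists2 y, y \in N i & delta x y <= s i.
Hypothesis chi_inj : forall i x y, x \in N i -> y \in N i ->
  delta x y <= 4 * s i.+1 -> chi i x = chi i y -> x = y.

Let le4 i : 4 * s i <= 4 * s i.+1.
Proof. by have := s_growth i; have := s_gt0 i; lra. Qed.

(* Within distance 2 * s i of y there is at most one net point of colour c. *)
Lemma parent_exists c : exists par : nat -> X -> X,
  forall i y, [/\ par i y \in N i, delta y (par i y) <= 2 * s i &
    forall z, z \in N i -> chi i z = c -> delta y z <= 2 * s i -> par i y = z].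
Proof.
suff /choice[par hpar] : forall e : nat * X, exists x, [/\ x \in N e.1,
    delta e.2 x <= 2 * s e.1 &
    forall z, z \in N e.1 -> chi e.1 z = c -> delta e.2 z <= 2 * s e.1 -> x = z].
  by exists (fun i y => par (i, y)) => i y; apply: hpar (i, y).
move=> [i y] /=.
have [/existsP[z /and3P[zN /eqP zc yz]]|/existsPn no] :=
    boolP [exists z, [&& z \in N i, chi i z == c & delta y z <= 2 * s i]].
  exists z; split=> // z' z'N z'c yz'; apply: (@chi_inj i) => //; last by rewrite z'c.
  have := delta_tri delta_metric y z z'; rewrite (deltaC delta_metric z y).
  by have := le4 i; lra.
have [x xN yx] := N_cov i y; exists x; split=> //.
  by have := s_gt0 i; lra.
by move=> z zN zc yz; have := no z; rewrite zN zc eqxx yz.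
Qed.

(** Points with the same ancestor [anc i] form a level [i] cluster of radius [3 * s i], hence the
    diameter bound. The ancestors depend on [c1] only and come before [c2], because the caller picks
    [c2] as the colour of [anc j u]. *)
Lemma hierarchy c1 : exists anc : nat -> X -> X, (forall i p, anc i p \in N i) /\
  forall c2, exists L, leader_system delta L h (fun i => 6 * s i) /\
    forall u v j x, x \in N j.+1 -> chi j.+1 x = c1 -> delta u x <= s j.+1 ->
      delta u v <= s j.+1 / 4 -> chi j (anc j u) = c2 -> 6 * s j < delta u v ->
      [/\ L j.+1 u = L j.+1 v, L j u <> L j v & L j.+1 u = L j u].
Proof.
have [par hpar] := parent_exists c1.
pose anc := fix anc i p := if i is i'.+1 then par i (anc i' p) else p.
have ancS i p : anc i.+1 p = par i.+1 (anc i p) by [].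
have N0 p : p \in N 0%N.
  have [y yN py] := N_cov 0 p; have [->//|/eqP/s_min] := eqVneq p y.
  by rewrite ltNge py.
have ancN i p : anc i p \in N i.
  by case: i => [//|i]; rewrite ancS; case: (hpar i.+1 (anc i p)).
have anc_near i p : delta p (anc i p) <= 3 * s i.
  elim: i => [|i IHi]; first by rewrite (deltaxx delta_metric) mulr_ge0 // ltW.
  have [_ hp _] := hpar i.+1 (anc i p).
  have := delta_tri delta_metric (anc i p) p (anc i.+1 p); rewrite ancS.
  by have := s_growth i; have := s_gt0 i; lra.
have anc_mono i j p q : (i <= j)%N -> anc i p = anc i q -> anc j p = anc j q.
  by move/subnK <-; elim: (j - i)%N => [//|k IHk] /IHk; rewrite addSn !ancS => ->.
exists anc; split=> // c2.
(* A cluster takes its leader from one child cluster, namely that of [sel], and prefers a child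
   whose net point has colour [c2]. *)
have /choice[sel hsel] : forall e : nat * X, exists q,
    (exists q', anc e.1.+1 q' = e.2) -> anc e.1.+1 q = e.2 /\
    ((exists q', anc e.1.+1 q' = e.2 /\ chi e.1 (anc e.1 q') = c2) ->
      chi e.1 (anc e.1 q) = c2).
  move=> [i y] /=.
  have [[q' [q1 q2]]|no] := EM (exists q', anc i.+1 q' = y /\ chi i (anc i q') = c2).
    by exists q'.
  have [[q' q1]|no'] := EM (exists q', anc i.+1 q' = y).
    by exists q' => _; split=> // /no.
  by exists y => /no'.
pose L := fix L i p := if i is i'.+1 then L i' (sel (i', anc i p)) else p.
have LS i p : L i.+1 p = L i (sel (i, anc i.+1 p)) by [].
have selP i p : anc i.+1 (sel (i, anc i.+1 p)) = anc i.+1 p.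
  by have [] := hsel (i, anc i.+1 p) (ex_intro _ p erefl).
have ancL i p : anc i (L i p) = anc i p.
  elim: i p => [//|i IHi] p; rewrite -[RHS]selP LS ancS IHi //.
have L_anc i p q : anc i p = anc i q -> L i p = L i q.
  by case: i => [//|i] e; rewrite !LS e.
have anc_L i p q : L i p = L i q -> anc i p = anc i q.
  by move=> e; rewrite -ancL e ancL.
have LL i j p : L i (L j p) = L (maxn i j) p.
  have [ji|/ltnW ij] := leqP j i.
    by apply/L_anc/(anc_mono j).
  rewrite -(subnK ij); elim: (j - i)%N p => [|k IHk] p.
    by apply/L_anc/ancL.
  by rewrite addSn LS IHk.
have L_diam i p q : L i p = L i q -> delta p q <= 6 * s i.
  move/anc_L => e; have := anc_near i p; have := anc_near i q.
  have := delta_tri delta_metric (anc i p) p q.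
  by rewrite (deltaC delta_metric (anc i p) q) e; lra.
exists L; split.
  split=> //.
    move=> p q; apply/L_anc/eqP/negPn/negP => /eqP ne.
    have := separatedP _ _ _ (N_sep h) _ _ (ancN h p) (ancN h q) ne.
    by rewrite ltNge s_max.
  by move=> i; have := s_growth i; have := s_gt0 i; lra.
move=> u v j x xN xc ux uv cu far.
have growth := s_growth j; have sj := s_gt0 j; have sj1 := s_gt0 j.+1.
have ancu : anc j.+1 u = x.
  rewrite ancS; have [_ _] := hpar j.+1 (anc j u); apply=> //.
  have := delta_tri delta_metric u (anc j u) x; have := anc_near j u.
  by rewrite (deltaC delta_metric (anc j u) u); lra.
(* The distance from [anc j v] to [x] is at most [3/4 + 1/4 + 1 = 2] times [s j.+1], just the range
   in which a parent of colour [c1] is found. *)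
have ancv : anc j.+1 v = x.
  rewrite ancS; have [_ _] := hpar j.+1 (anc j v); apply=> //.
  have := delta_tri delta_metric v (anc j v) x; have := anc_near j v.
  have := delta_tri delta_metric u v x.
  by rewrite (deltaC delta_metric (anc j v) v) (deltaC delta_metric v u); lra.
split; first by apply: L_anc; rewrite ancu.
  by move/L_diam; rewrite leNgt far.
(* The children [anc j q] and [anc j u] have colour [c2] and lie within [2 * s j.+1] of [x], so they
   coincide by [chi_inj]. *)
rewrite LS; apply: L_anc; set q := sel _.
have [/= q1 q2] := hsel (j, anc j.+1 u) (ex_intro _ u erefl).
rewrite -/q in q1 q2; have {q2}cq : chi j (anc j q) = c2 by apply: q2; exists u.
apply: (@chi_inj j); rewrite ?cq //.
have near w : anc j.+1 w = x -> delta (anc j w) x <= 2 * s j.+1.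
  by move=> <-; case: (hpar j.+1 (anc j w)).
have nu := near u ancu; have nq := near q (etrans q1 ancu).
have := delta_tri delta_metric x (anc j q) (anc j u).
by rewrite (deltaC delta_metric x (anc j u)); lra.
Qed.

(** There is one tree for each pair of colours. For [u] and [j], [c1] is the colour of a net point
    covering [u] at level [j.+1] and [c2] that of the ancestor of [u] at level [j]; the excess is
    [12 * 6 * s j]. *)
Lemma hierarchy_spanner (D l : nat) : (forall i x, x \in N i -> (chi i x < D)%N) ->
  exists out : 'I_D * 'I_D -> X -> {set X},
  (forall c u, #|out c u| <= 192 * maxn 1 (inv_ackermann l.+2 #|X|))%N /\
  forall u v j, 6 * s j < delta u v -> delta u v <= s j.+1 / 4 ->
    exists c, reach delta (fun x y => [|| x == y, y \in out c x | x \in out c y])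
      (2 * l + 2) u v (delta u v + 72 * s j).
Proof.
move=> chiD.
have /choice[anc hanc] := fun c1 : 'I_D => hierarchy c1.
have /choice[out hout] : forall c : 'I_D * 'I_D, exists out : X -> {set X},
   (forall u, #|out u| <= 192 * maxn 1 (inv_ackermann l.+2 #|X|))%N /\
   forall u v j x, x \in N j.+1 -> chi j.+1 x = c.1 -> delta u x <= s j.+1 ->
      delta u v <= s j.+1 / 4 -> chi j (anc c.1 j u) = c.2 -> 6 * s j < delta u v ->
    reach delta (fun x y => [|| x == y, y \in out x | x \in out y])
      (2 * l + 2) u v (delta u v + 72 * s j).
  move=> [c1 c2] /=; have [_ /(_ c2)[L [sysL hL]]] := hanc c1.
  have D0 i : 0 <= 6 * s i by rewrite mulr_ge0 // ltW.
  have [out [k1 k2]] := leader_spanner delta_metric sysL D0 l.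
  exists out; split=> // u v j x h1 h2 h3 h4 h5 h6.
  have [e1 e2 e3] := hL u v j x h1 h2 h3 h4 h5 h6.
  apply: reach_leq (leqnn _) _ (k2 _ _ _ e1 e2 e3); lra.
exists out; split=> [c u|u v j far near]; first by case: (hout c).
have [x xN ux] := N_cov j.+1 u.
pose c1 := Ordinal (chiD _ _ xN).
have [aN _] := hanc c1.
pose c2 := Ordinal (chiD _ _ (aN j u)).
exists (c1, c2); have [_ k] := hout (c1, c2).
exact: (k u v j x).
Qed.

End Hierarchy.

(** * The spanner *)

(** Charging each edge to its owner gives at most [D * #|V|] edges on [V], and
    [#|V| <= 2 * (#|V| - 1)] as [#|V|] is at least 2. *)
Lemma arboricity_le (X : finType) (out : X -> {set X}) (E : {set {set X}}) D :
  (forall e, e \in E -> exists u v, e = [set u; v]%SET /\ v \in out u) ->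
  (forall u, #|out u| <= D)%N -> (arboricity E <= 2 * D)%N.
Proof.
move=> hE hD; rewrite /arboricity; apply/bigop.bigmax_leqP => -[V F] /= /andP[/andP[/= FE FV] V2].
move/forall_inP in FV.
have cardF : (#|F| <= D * #|V|)%N.
  have sub : F \subset \bigcup_(u in V) [set [set u; v]%SET | v in out u].
    apply/fintype.subsetP => e eF; have [u [v [euv vu]]] := hE e (fintype.subsetP FE _ eF).
    apply/finset.bigcupP; exists u; last by rewrite euv; apply: imset_f.
    by apply: (fintype.subsetP (FV e eF)); rewrite euv !inE eqxx.
  exact: leq_trans (subset_leq_card sub) (leq_card_bigcup_imset _ _ hD).
have le2 : (#|F| <= 2 * D * (#|V| - 1))%N by nia.
have q0 : 0 <= #|F|%:R / (#|V| - 1)%:R :> rat by rewrite divr_ge0.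
have c0 : 0 <= Num.ceil (#|F|%:R / (#|V| - 1)%:R : rat).
  by rewrite -(ler_int rat); apply: le_trans q0 (ceil_ge _).
rewrite -lez_nat gez0_abs // ceil_le_int ler_pdivrMr ?ltr0n ?subn_gt0 //.
by rewrite -[_%:~R]/((2 * D)%:R) -natrM ler_nat.
Qed.

(** * Union over scales and colours *)

Section Assembly.
Variables (R : realType) (X : finType) (delta : X -> X -> R).
Hypothesis delta_metric : is_metric delta.

Lemma delta_gt0 x y : x <> y -> 0 < delta x y.
Proof.
move=> xy; rewrite lt_neqAle (delta_ge0 delta_metric) andbT eq_sym.
by apply/eqP => /(delta_eq0 delta_metric).
Qed.

Lemma min_distance : (1 < #|X|)%N ->
  exists x y, x <> y /\ forall u v, u <> v -> delta x y <= delta u v.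
Proof.
move=> X2; have /card_gt1P[x0 [y0 [_ _ xy0]]] : (1 < #|[set: X]%SET|)%N by rewrite cardsT.
pose P (e : X * X) := e.1 != e.2.
have P0 : P (x0, y0) by [].
case: (arg_minP (fun e => delta e.1 e.2) P0) => -[x y] /= /eqP xy xymin.
by exists x, y; split=> // u v /eqP uv; apply: (xymin (u, v)).
Qed.

(** For a closest pair [x, y], balls of half their distance are single points, so covering the ball
    around [x] through [y] takes at least two. *)
Lemma doubling_ge1 d : (1 < #|X|)%N -> is_doubling delta d -> 1 <= d.
Proof.
move=> X2 dd; have [x [y [xy xymin]]] := min_distance X2.
have r0 := delta_gt0 xy; have [S hS cov] := dd x _ r0.
have own z : delta x z <= delta x y -> z \in S.
  move=> /cov[c cS cz]; have [<-//|/eqP/xymin] := eqVneq c z; lra.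
have S2 : (2 <= #|S|)%N.
  apply: (@leq_trans #|[set x; y]%SET|); first by rewrite cards2; move/eqP: xy => ->.
  apply: subset_leq_card; apply/fintype.subsetP => z; rewrite !inE => /orP[]/eqP->;
    apply: own => //.
  by rewrite (deltaxx delta_metric) ltW.
have : ln 2 <= ln (2 `^ d) :> R.
  by rewrite ler_ln ?posrE ?powR_gt0 //; apply: le_trans hS; rewrite (ler_nat _ 2).
by rewrite ln_powR ler_pMl ?ln_gt0 ?ltr1n.
Qed.

(** The number of colours comes from packing balls of radius [4 * s j.+1 = 2 ^ (b + 2) * s j] with
    points more than [s j] apart. *)
Lemma scale_spanner (d s0 : R) (b l : nat) : is_doubling delta d -> (1 < b)%N -> 0 < s0 ->
  (forall x y, x <> y -> s0 < delta x y) ->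
  let D := Num.truncn ((2 `^ d) ^+ (b + 3) : R) in
  let s j := (2 ^+ b) ^+ j * s0 in
  exists out : 'I_D * 'I_D -> X -> {set X},
  (forall c u, #|out c u| <= 192 * maxn 1 (inv_ackermann l.+2 #|X|))%N /\
  forall u v j, 6 * s j < delta u v -> delta u v <= s j.+1 / 4 ->
    exists c, reach delta (fun x y => [|| x == y, y \in out c x | x \in out c y])
      (2 * l + 2) u v (delta u v + 72 * s j).
Proof.
move=> dd b1 s00 smin D s.
have sS j : s j.+1 = 2 ^+ b * s j by rewrite /s exprS mulrA.
have Q4 : 4 <= 2 ^+ b :> R.
  by rewrite -natrX (ler_nat _ 4); apply: (@leq_trans (2 ^ 2)); rewrite ?leq_exp2l.
have s_gt0 j : 0 < s j by rewrite mulr_gt0 // exprn_gt0 // exprn_gt0.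
have s_growth j : 4 * s j <= s j.+1 by rewrite sS ler_wpM2r // ltW.
have /choice[N hN] := fun j => net_exists delta_metric (ltW (s_gt0 j)).
have [h hh] : exists h, forall x y, delta x y <= s h.
  pose M := \sum_x \sum_y delta x y.
  have M0 x y : delta x y <= M.
    rewrite /M (bigD1 x) //= (bigD1 y) //= -addrA lerDl.
    by rewrite addr_ge0 ?sumr_ge0 // => z _; rewrite ?sumr_ge0 // => *; apply: delta_ge0.
  exists (Num.bound (M / s0)) => x y; apply: le_trans (M0 x y) _.
  rewrite /s -ler_pdivrMr //; apply: le_trans (ltW (upper_nthrootP (leqnn _))) _.
  by rewrite lerXn2r ?nnegrE ?ler0n ?exprn_ge0 //; apply: le_trans Q4; lra.
have /choice[chi hchi] : forall j, exists chi : X -> nat,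
    (forall x, x \in N j -> (chi x < D)%N) /\
    forall x y, x \in N j -> y \in N j -> delta x y <= 4 * s j.+1 -> chi x = chi y -> x = y.
  move=> j; apply: coloring_exists => //; first by rewrite mulr_ge0 // ltW.
  move=> x xN; rewrite truncn_ge_nat; last by rewrite exprn_ge0 // powR_ge0.
  apply: (packing delta_metric (s := s j) (r := 4 * s j.+1) (x := x) dd).
  - by rewrite mulr_gt0.
  - apply/separatedP => y z; rewrite !inE => /andP[yN _] /andP[zN _].
    exact: (separatedP _ _ _ (hN j).1).
  - by move=> y; rewrite !inE => /andP[].
  by rewrite sS exprD mulrA; lra.
apply: (hierarchy_spanner delta_metric (N := N) (chi := chi) (h := h)) => //.
- by move=> x y /smin; rewrite /s expr0 mul1r.
- by move=> j; case: (hN j).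
- by move=> j; case: (hN j).
- by move=> j; case: (hchi j).
by move=> j; case: (hchi j).
Qed.

Lemma six_le_exp4 (x : R) : 6 <= x -> 1296 <= x ^+ 4.
Proof.
move=> x6; have : 6 ^+ 4 <= x ^+ 4 by rewrite lerXn2r ?nnegrE //; apply: le_trans x6.
by rewrite -natrX.
Qed.

(* Two interleaved families of scales, of ratio q ^ 2 each: every distance then lies
   in [72 * s j / eps, s j.+1 / 4] for some scale s of one of them. *)
Lemma union_spanner (d eps : R) (l : nat) : (1 < #|X|)%N -> is_doubling delta d ->
  0 < eps -> eps < 1 / 6 ->
  exists (D : nat) (out : X -> {set X}), [/\ D%:R <= (eps^-1 ^+ 12) `^ d,
   (forall u, #|out u| <= 384 * D ^ 2 * maxn 1 (inv_ackermann l.+2 #|X|))%N &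
   forall u v, reach delta (fun x y => [|| x == y, y \in out x | x \in out y])
      (2 * l + 2) u v ((1 + eps) * delta u v)].
Proof.
move=> X2 dd eps0 eps6; set A := maxn 1 _.
have e6 : 6 <= eps^-1 by rewrite -[leLHS]invrK lef_pV2 ?posrE ?invr_gt0 //; lra.
(* The ratio [q] is the least power of two above [288 / eps], where [288 = 4 * 72] turns
   [delta u v > q * z / 4] into [72 * z < eps * delta u v]. *)
have [a [qa qb]] : exists a, 288 / eps <= 2 ^+ a.+1 /\ 2 ^+ a.+1 <= 576 / eps.
  have ex : exists a, 288 / eps <= 2 ^+ a.
    by exists (Num.bound (288 / eps)); apply/ltW/upper_nthrootP.
  case: (ex_minnP ex) => -[|a] ha amin; first by rewrite expr0 in ha; lra.
  exists a; split=> //; rewrite leNgt; apply/negP => lt.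
  suff /amin : 288 / eps <= 2 ^+ a by rewrite ltnn.
  by move: lt; rewrite exprS; lra.
set q : R := 2 ^+ a.+1 in qa qb; pose b := (a.+1 * 2)%N.
have q0 : 0 < q by rewrite exprn_gt0.
have q1 : 1 <= q by rewrite exprn_ege1 // ler1n.
have qbE : 2 ^+ b = q ^+ 2 :> R by rewrite /q -exprM.
have [x [y [xy xymin]]] := min_distance X2; have m0 := delta_gt0 xy.
(* Both families start below the least distance: at [sg] and at [q * sg], half that distance. *)
pose sg := delta x y / (2 * q).
have sg0 : 0 < sg by rewrite divr_gt0 // mulr_gt0.
have qsg : q * sg = delta x y / 2 by rewrite /sg; field; lra.
have s1 u v : u <> v -> q * sg < delta u v by move/xymin; rewrite qsg; lra.
have s2 u v : u <> v -> sg < delta u v.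
  move=> uv; apply: le_lt_trans (s1 u v uv); by rewrite ler_peMl // ltW.
have b1 : (1 < b)%N by rewrite /b muln2 doubleS.
have [out0 [h0 k0]] := scale_spanner l dd b1 sg0 s2.
have [out1 [h1 k1]] := scale_spanner l dd b1 (mulr_gt0 q0 sg0) s1.
set D := Num.truncn _ in out0 h0 k0 out1 h1 k1.
exists D, (fun u => (\bigcup_c out0 c u) :|: (\bigcup_c out1 c u))%SET.
have d1 := doubling_ge1 X2 dd.
split.
- apply: (@le_trans _ _ ((2 `^ d) ^+ (b + 3))).
    by rewrite -truncn_ge_nat // exprn_ge0 // powR_ge0.
  rewrite -powR_mulrn ?powR_ge0 // powRAC powR_mulrn //.
  apply: ge0_ler_powR; rewrite ?nnegrE ?exprn_ge0 //; [lra|by rewrite invr_ge0 ltW|].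
  (* The base is [8 * q ^ 2], with [q <= 576 / eps <= eps^-1 ^+ 5] and [8 <= eps^-1 ^+ 2]. *)
  rewrite exprD qbE (_ : 12 = 5 * 2 + 2)%N // [_ ^+ (5 * 2 + 2)]exprD exprM.
  have q5 : q <= eps^-1 ^+ 5.
    apply: le_trans qb _; rewrite exprSr ler_wpM2r ?invr_ge0 ?(ltW eps0) //.
    by apply: le_trans (six_le_exp4 e6); rewrite ler_nat.
  have e2 : 2 ^+ 3 <= eps^-1 ^+ 2.
    have : 6 ^+ 2 <= eps^-1 ^+ 2 by rewrite lerXn2r ?nnegrE ?invr_ge0 // ltW.
    by apply: le_trans; rewrite -!natrX ler_nat.
  by rewrite ler_pM ?exprn_ge0 ?(ltW q0) // lerXn2r ?nnegrE ?exprn_ge0 ?invr_ge0 // ltW.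
- move=> u; apply: leq_trans (leq_card_setU _ _) _.
  have half (o : 'I_D * 'I_D -> X -> {set X}) :
      (forall c u, #|o c u| <= 192 * A)%N -> (#|(\bigcup_c o c u)%SET| <= D ^ 2 * (192 * A))%N.
    move=> ho; apply: leq_trans (leq_card_bigcup _ _) _.
    apply: (@leq_trans (\sum_(c : 'I_D * 'I_D) 192 * A)%N); first by apply: leq_sum.
    by rewrite sum_nat_const card_prod !card_ord mulnn.
  apply: leq_trans (leq_add (half _ h0) (half _ h1)) _.
  by apply: eq_leq; ring.
move=> u v; have [->|/eqP uv] := eqVneq u v.
  by apply: reach_refl; rewrite mulr_ge0 ?(delta_ge0 delta_metric) //; lra.
have duv := delta_gt0 uv.
have ex : exists m, delta u v <= q ^+ m * sg / 4.
  exists (Num.bound (delta u v * 4 / sg)).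
  rewrite ler_pdivlMr // -ler_pdivrMr //; apply: le_trans (ltW (upper_nthrootP (leqnn _))) _.
  by rewrite lerXn2r ?nnegrE ?ler0n ?(ltW q0) // /q exprS ler_peMr // exprn_ege1 // ler1n.
(* The least exponent is some [m.+2], since 0 and 1 would put [delta u v] below the least distance.
   The scale is [q ^+ m * sg]: the parity of [m] selects the family, and [j = m./2]. *)
case: (ex_minnP ex) => -[|[|m]] hm mmin.
- by have := s2 u v uv; rewrite expr0 in hm; lra.
- by have := s1 u v uv; rewrite expr1 in hm; lra.
have far : q ^+ m.+1 * sg / 4 < delta u v.
  by rewrite ltNge; apply/negP => /mmin; rewrite ltnn.
have eps_s : 72 * (q ^+ m * sg) < eps * delta u v.
  move: far; rewrite exprS -(mulrA q); set z := q ^+ m * sg => far.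
  have z0 : 0 < z by rewrite mulr_gt0 // exprn_gt0.
  have : 288 / eps * z <= q * z by rewrite ler_pM2r.
  have -> : 288 / eps * z = 4 * (72 * z / eps) by field; lra.
  move=> hz; rewrite -ltr_pdivrMl // [eps^-1 * _]mulrC.
  lra.
have eps_d : eps * delta u v < delta u v by rewrite gtr_pMl //; lra.
have sE o : odd m = o -> (2 ^+ b) ^+ m./2 * (q ^+ o * sg) = q ^+ m * sg.
  by move=> <-; rewrite qbE -exprM mulrA -exprD mul2n addnC odd_double_half.
have z0 : 0 < q ^+ m * sg by rewrite mulr_gt0 // exprn_gt0.
have sSE o : odd m = o -> (2 ^+ b) ^+ m./2.+1 * (q ^+ o * sg) = q ^+ m.+2 * sg.
  by move=> e; rewrite exprS -mulrA (sE _ e) qbE mulrA -exprD.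
have le_c : delta u v + 72 * (q ^+ m * sg) <= (1 + eps) * delta u v.
  by rewrite mulrDl mul1r; lra.
case odd_m : (odd m).
  have := sE _ odd_m; have := sSE _ odd_m; rewrite expr1 => e1 e2.
  have [||c k] := k1 u v m./2; rewrite ?e1 ?e2 //; first lra.
  rewrite e2 in k; apply: (reach_sub delta_metric) (reach_leq (leqnn _) le_c k).
  move=> z t /or3P[/eqP->|tz|zt]; first by left.
    right; apply/or3P/Or32; rewrite finset.in_setU; apply/orP; right.
    by apply/finset.bigcupP; exists c.
  right; apply/or3P/Or33; rewrite finset.in_setU; apply/orP; right.
  by apply/finset.bigcupP; exists c.
have := sE _ odd_m; have := sSE _ odd_m; rewrite expr0 mul1r => e1 e2.
have [||c k] := k0 u v m./2; rewrite ?e1 ?e2 //; first lra.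
rewrite e2 in k; apply: (reach_sub delta_metric) (reach_leq (leqnn _) le_c k).
move=> z t /or3P[/eqP->|tz|zt]; first by left.
  right; apply/or3P/Or32; rewrite finset.in_setU; apply/orP; left.
  by apply/finset.bigcupP; exists c.
right; apply/or3P/Or33; rewrite finset.in_setU; apply/orP; left.
by apply/finset.bigcupP; exists c.
Qed.

End Assembly.

Lemma hop_diameter_spanner (R : realType) (X : finType) (delta : X -> X -> R) t E k :
  simple_graph E -> spanner_hop_diameter delta t E k -> spanner delta t E.
Proof.
move=> sE h; split=> // u v; have [p [h1 h2 h3 _]] := h u v.
apply: ge_ereal_inf; exists (walk_length delta u p)%:E; last by rewrite lee_fin.
by exists p.
Qed.

Theorem theorem1p5 (R : realType) :
  exists2 C : R, 0 < C &
    forall (k : nat) (eps : R),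
      (0 < k)%N -> ~~ odd k -> 0 < eps -> eps < 1 / 6 ->
    forall n : nat, (0 < n)%N ->
    forall (X : finType) (delta : X -> X -> R) (d : R),
      is_metric delta -> #|X| = n -> doubling_dimension delta d ->
    exists E : {set {set X}},
      [/\ spanner delta (1 + eps) E,
          spanner_hop_diameter delta (1 + eps) E k
        & (arboricity E)%:R <=
            eps `^ (- (C * d)) * (maxn 1 (inv_ackermann (k %/ 2 + 1) n))%:R].
Proof.
(* [28 = 12 + 12 + 4]: 12 for each factor [D], and 4 to absorb the constant [768 = 2 * 384] with the
   help of [1 <= d]. *)
exists 28; first by [].
move=> k eps k0 kodd eps0 eps6 n n0 X delta d dm cardX [dd _].
(* A single point takes the empty graph; the bound [1 <= d] used afterwards requires two points. *)
have [X1|X2] := leqP #|X| 1.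
  have hop : spanner_hop_diameter delta (1 + eps) finset.set0 k.
    move=> u v; have -> : v = u by apply: (fintype_le1P X1).
    exists [::]; split=> //; rewrite /walk_length big_nil (deltaxx dm) mulr0 //.
  exists finset.set0; split=> //.
    by apply: hop_diameter_spanner hop => e; rewrite inE.
  apply: (@le_trans _ _ 0); last by rewrite mulr_ge0 // powR_ge0.
  rewrite (ler_nat _ _ 0); apply: (@leq_trans (2 * 0)) => //.
  apply: (@arboricity_le _ (fun=> finset.set0)) => [e|u]; rewrite ?inE ?cards0 //.
have {k0 kodd} [l kE] : exists l, k = (2 * l + 2)%N.
  by exists (k./2.-1); have := odd_double_half k; rewrite (negPf kodd); lia.
have [D [out [hD hout hreach]]] := union_spanner dm l X2 dd eps0 eps6.
have -> : (k %/ 2 + 1 = l.+2)%N by rewrite kE; lia.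
rewrite cardX in hout; set A := maxn 1 _ in hout *.
(* The orientation is forgotten and loops are dropped; the steps [x == y] of the walks disappear
   through [reach_sub]. *)
pose E := [set [set e.1; e.2]%SET | e in [set e : X * X | (e.2 \in out e.1) && (e.1 != e.2)]%SET]%SET.
have EP u v : v \in out u -> u != v -> [set u; v]%SET \in E.
  by move=> vu uv; apply/imsetP; exists (u, v); rewrite // inE vu.
have hop : spanner_hop_diameter delta (1 + eps) E k.
  move=> u v; rewrite kE; have := hreach u v; apply: (reach_sub dm) => x y.
  have [->|xy] := eqVneq x y; first by left.
  case/or3P=> // h; right; rewrite /adj; first exact: EP.
  by rewrite finset.setUC; apply: EP => //; rewrite eq_sym.
exists E; split=> //.
  apply: hop_diameter_spanner hop => e /imsetP[[u v]]; rewrite inE /= => /andP[_ uv] ->.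
  by rewrite cards2 uv.
have arb : (arboricity E <= 2 * (384 * D ^ 2 * A))%N.
  apply: (@arboricity_le _ out) => // e /imsetP[[u v]]; rewrite inE /= => /andP[vu _] ->.
  by exists u, v.
have d1 := doubling_ge1 dm X2 dd.
set x := eps^-1 in hD.
have x6 : 6 <= x by rewrite /x -[leLHS]invrK lef_pV2 ?posrE ?invr_gt0 //; lra.
have x0 : 0 <= x by lra.
have -> : eps `^ (- (28 * d)) = (x ^+ 4) `^ d * ((x ^+ 12) `^ d * (x ^+ 12) `^ d).
  rewrite -!powRM ?mulr_ge0 ?exprn_ge0 // -!exprD -mulNr powRrM powR_invn; last lra.
  by rewrite exprVn.
have x4 : 768 <= (x ^+ 4) `^ d.
  apply: (@le_trans _ _ (x ^+ 4)); first by apply: le_trans (six_le_exp4 x6); rewrite ler_nat.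
  by apply: le1r_powR => //; rewrite exprn_ege1 //; lra.
move: arb; rewrite -(ler_nat R) => /le_trans; apply.
have -> : (2 * (384 * D ^ 2 * A))%:R = 768 * (D%:R * D%:R) * A%:R :> R.
  by rewrite -mulnn !natrM; ring.
have D0 : 0 <= D%:R :> R := ler0n _ _.
apply: ler_wpM2r; first exact: ler0n.
exact: ler_pM (ler0n _ _) (mulr_ge0 D0 D0) x4 (ler_pM D0 D0 hD hD).
Qed.
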